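(* Let \(G\) be a subgroup of \(\operatorname{PL}_+(I)\) generated by \(n\) elements whose support (the union of the supports of its elements) is connected. Then either \(G\) contains a subgroup isomorphic to Thompson's group \(F\), or \(G\) admits a generating set with \(n\) elements which is geometrically proper.
   Context: \(I=[0,1]\); \(\operatorname{PL}_+(I)\) is the group of piecewise linear orientation preserving homeomorphisms of \(I\). The support of \(f\) is \(\{t\in I: tf\neq t\}\). A left (right) transition point of \(f\) is a point \(t\) not in the support of \(f\) such that for every \(\epsilon>0\), \((t,t+\epsilon)\) (resp. \((t-\epsilon,t)\)) meets the support of \(f\). A set \(X\) of homeomorphisms is geometrically proper if no point of \(I\) is a left transition point of two distinct elements of \(X\) and no point is a right transition point of two distinct elements of \(X\). *)

(* Defs.v *)
From Stdlib Require Import Reals List.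
Open Scope R_scope.

(* Elements of PL_+(I), I = [0,1], are modelled as functions R -> R that are
   the identity outside [0,1].  The (right) action t f is written f t and the
   product f g (first f, then g) is fun t => g (f t). *)

Definition affine_on (f : R -> R) (a b : R) : Prop :=
  exists m c : R, forall t, a <= t <= b -> f t = m * t + c.

Definition PL_plus (f : R -> R) : Prop :=
  (forall t, t < 0 \/ 1 < t -> f t = t) /\
  f 0 = 0 /\ f 1 = 1 /\
  (forall s t, 0 <= s -> s < t -> t <= 1 -> f s < f t) /\
  exists (k : nat) (b : nat -> R),
    b 0%nat = 0 /\ b k = 1 /\
    (forall i, (i < k)%nat -> b i < b (S i)) /\
    (forall i, (i < k)%nat -> affine_on f (b i) (b (S i))).

Inductive gen (S : (R -> R) -> Prop) : (R -> R) -> Prop :=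
| gen_id : gen S (fun t => t)
| gen_in : forall f, S f -> gen S f
| gen_mul : forall f g, gen S f -> gen S g -> gen S (fun t => g (f t))
| gen_inv : forall f h, gen S f -> (forall t, h (f t) = t) ->
                        (forall t, f (h t) = t) -> gen S h.

Definition gen_list (l : list (R -> R)) : (R -> R) -> Prop :=
  gen (fun f => In f l).

Definition supp (f : R -> R) (t : R) : Prop := 0 <= t <= 1 /\ f t <> t.

Definition group_supp (G : (R -> R) -> Prop) (t : R) : Prop :=
  exists f, G f /\ supp f t.

(* connected subsets of R are exactly the intervals (order-convex sets) *)
Definition connected_set (A : R -> Prop) : Prop :=
  forall x y z, A x -> A y -> x <= z <= y -> A z.

Definition left_transition (f : R -> R) (t : R) : Prop :=
  0 <= t <= 1 /\ ~ supp f t /\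
  forall eps, 0 < eps -> exists s, t < s < t + eps /\ supp f s.

Definition right_transition (f : R -> R) (t : R) : Prop :=
  0 <= t <= 1 /\ ~ supp f t /\
  forall eps, 0 < eps -> exists s, t - eps < s < t /\ supp f s.

Definition geom_proper (X : list (R -> R)) : Prop :=
  forall f g t, In f X -> In g X -> f <> g ->
    ~ (left_transition f t /\ left_transition g t) /\
    ~ (right_transition f t /\ right_transition g t).

Definition dyadic (x : R) : Prop := exists (a : Z) (k : nat), x = IZR a / 2 ^ k.

Definition ThompsonF (f : R -> R) : Prop :=
  PL_plus f /\
  exists (k : nat) (b : nat -> R),
    b 0%nat = 0 /\ b k = 1 /\
    (forall i, (i < k)%nat -> b i < b (S i)) /\
    (forall i, (i <= k)%nat -> dyadic (b i)) /\
    (forall i, (i < k)%nat -> exists (z : Z) (c : R),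
       forall t, b i <= t <= b (S i) -> f t = powerRZ 2 z * t + c).

Definition contains_F (G : (R -> R) -> Prop) : Prop :=
  exists phi : (R -> R) -> (R -> R),
    (forall f, ThompsonF f -> G (phi f)) /\
    (forall f g, ThompsonF f -> ThompsonF g ->
       phi (fun t => g (f t)) = (fun t => phi g (phi f t))) /\
    (forall f g, ThompsonF f -> ThompsonF g -> phi f = phi g -> f = g).

(* Main.v *)
(** Let (a, b) be the support of G.  The right slope at a is a homomorphism from G to the
    positive reals.

    G contains Thompson's group F if some element is trivial near a but not near b, or if
    the slopes at a are nondiscrete.  In the latter case some nontrivial element has slope
    1 at a: otherwise G is abelian, and PL maps with arbitrarily small log-slopes at a
    cannot commute on all of (a, b).  In both cases one finds x0, x1 in G and s < t such
    that x1 is the identity below s, x0 = x1 above t and t <= x0 s.  Then X_0 = x0 and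
    X_{n+1} = x0^n x1 x0^-n satisfy the relations of the infinite presentation of F, so
    that pairs of binary trees act through positive words in the X_n, and the orbit
    s < x0 s < x0^2 s < ... shows that the action is faithful.

    If the slopes at a are discrete, the Euclidean algorithm turns the n generators into
    n generators of which only one is nontrivial near a, hence only one near b.  A
    transition point of one of the others lies in (a, b), so it is moved by the group that
    the remaining generators span; conjugating by an element of that group makes its
    transition points disjoint from those of the rest. *)

Require Import Defs.
From Stdlib Require Import Reals List Lra Lia Arith ZArith.
From Stdlib Require Import Classical ClassicalEpsilon FunctionalExtensionality.
Import ListNotations.
Open Scope R_scope.

(** * Binary trees and their words *)

(** The embedding of F avoids normal forms. An element of F is given by trees [T] and [S] with
    equally many leaves, and its image is the [h] with [spine_word S (h x) = spine_word T x].
    Splitting the same leaf in both trees puts the same letter, or none, on both sides, so the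
    equation survives refinement; full trees are cofinal, so any two pairs for one element can be
    compared over one domain tree. This makes the image unique, and uniqueness makes the map
    multiplicative. In the nondiscrete case the element with slope 1 at a may be trivial near both
    ends, and then no slope at b is available. Instead its support (u, v) is pushed by a homothety
    centred at a so that the image of v lands just to the right of u. The ratio must lie in a narrow
    window, which is exactly what nondiscreteness supplies. In the discrete case F is assumed
    absent. A generator trivial near a is then trivial near b as well, so the boundary of its fixed
    set lies strictly inside (a, b), where every point can be moved. *)

Inductive tree : Type := Leaf | Node (l r : tree).

Fixpoint nleaves (T : tree) : nat :=
  match T with Leaf => 1 | Node l r => nleaves l + nleaves r end.

Lemma nleaves_pos (T : tree) : (1 <= nleaves T)%nat.
Proof. induction T; simpl; lia. Qed.

Inductive split_leaf : tree -> nat -> tree -> Prop :=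
| split_root : split_leaf Leaf 0 (Node Leaf Leaf)
| split_left l l' r i : split_leaf l i l' -> split_leaf (Node l r) i (Node l' r)
| split_right l r r' i : split_leaf r i r' ->
    split_leaf (Node l r) (nleaves l + i) (Node l r').

Inductive refines : tree -> tree -> Prop :=
| refines_refl T : refines T T
| refines_step T i T' T'' : split_leaf T i T' -> refines T' T'' -> refines T T''.

Lemma split_leaf_lt T i T' : split_leaf T i T' -> (i < nleaves T)%nat.
Proof. induction 1; simpl; lia. Qed.

Lemma refines_trans T T' T'' : refines T T' -> refines T' T'' -> refines T T''.
Proof. induction 1; eauto using refines. Qed.

Lemma refines_node l l' r r' :
  refines l l' -> refines r r' -> refines (Node l r) (Node l' r').
Proof.
  intros Hl Hr. apply refines_trans with (Node l' r).
  - clear Hr. induction Hl; eauto using refines, split_leaf.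
  - clear Hl. induction Hr; eauto using refines, split_leaf.
Qed.

Fixpoint full_tree (N : nat) : tree :=
  match N with O => Leaf | S N => Node (full_tree N) (full_tree N) end.

Fixpoint depth (T : tree) : nat :=
  match T with Leaf => 0 | Node l r => S (max (depth l) (depth r)) end.

(** Cofinality of full trees: they serve below as common refinements of arbitrary finite families of
    trees. *)
Lemma refines_full_tree T N : (depth T <= N)%nat -> refines T (full_tree N).
Proof.
  revert T. induction N as [|N IH]; intros [|l r] H; simpl in *; try lia.
  - constructor.
  - apply refines_step with 0%nat (Node Leaf Leaf); [constructor|].
    apply refines_node; apply IH; simpl; lia.
  - apply refines_node; apply IH; lia.
Qed.

Fixpoint leaves (T : tree) (lo hi : R) : list (R * R) :=
  match T with
  | Leaf => [(lo, hi)]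
  | Node l r => leaves l lo ((lo + hi) / 2) ++ leaves r ((lo + hi) / 2) hi
  end.

Lemma length_leaves T lo hi : length (leaves T lo hi) = nleaves T.
Proof.
  revert lo hi. induction T; intros; simpl; [reflexivity|].
  rewrite length_app. congruence.
Qed.

Lemma leaves_split T i T' lo hi : split_leaf T i T' ->
  exists l1 p q l2, leaves T lo hi = l1 ++ (p, q) :: l2 /\ length l1 = i /\
    leaves T' lo hi = l1 ++ (p, (p + q) / 2) :: ((p + q) / 2, q) :: l2.
Proof.
  intros H. revert lo hi. induction H; intros lo hi; simpl.
  - exists [], lo, hi, []. auto.
  - destruct (IHsplit_leaf lo ((lo + hi) / 2)) as (l1 & p & q & l2 & E & Hl & E').
    exists l1, p, q, (l2 ++ leaves r ((lo + hi) / 2) hi).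
    rewrite E, E', <- !app_assoc. auto.
  - destruct (IHsplit_leaf ((lo + hi) / 2) hi) as (l1 & p & q & l2 & E & Hl & E').
    exists (leaves l lo ((lo + hi) / 2) ++ l1), p, q, l2.
    rewrite E, E', <- !app_assoc, length_app, length_leaves. auto.
Qed.

Lemma split_leaf_ex T i : (i < nleaves T)%nat -> exists T', split_leaf T i T'.
Proof.
  revert i. induction T as [|l IHl r IHr]; intros i H; simpl in H.
  - exists (Node Leaf Leaf). replace i with 0%nat by lia. constructor.
  - destruct (le_lt_dec (nleaves l) i) as [Hi|Hi].
    + destruct (IHr (i - nleaves l)%nat) as [r' Hr]; [lia|].
      exists (Node l r'). replace i with (nleaves l + (i - nleaves l))%nat by lia.
      constructor. exact Hr.
    + destruct (IHl i Hi) as [l' Hl]. exists (Node l' r). constructor. exact Hl.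
Qed.

Lemma leaves_in_range T lo hi p q :
  lo < hi -> In (p, q) (leaves T lo hi) -> lo <= p /\ p < q /\ q <= hi.
Proof.
  revert lo hi. induction T as [|l IHl r IHr]; intros lo hi H Hin; simpl in Hin.
  - destruct Hin as [E|[]]. injection E as -> ->. lra.
  - apply in_app_or in Hin as [Hin|Hin].
    + apply IHl in Hin; lra.
    + apply IHr in Hin; lra.
Qed.

Lemma leaves_cover T lo hi x : lo <= x <= hi ->
  exists p q, In (p, q) (leaves T lo hi) /\ p <= x <= q.
Proof.
  revert lo hi. induction T as [|l IHl r IHr]; intros lo hi H; simpl.
  - exists lo, hi. auto.
  - destruct (Rle_dec x ((lo + hi) / 2)) as [Hx|Hx].
    + destruct (IHl lo ((lo + hi) / 2)) as (p & q & Hin & Hpq); [lra|].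
      exists p, q. split; [apply in_or_app; auto|auto].
    + destruct (IHr ((lo + hi) / 2) hi) as (p & q & Hin & Hpq); [lra|].
      exists p, q. split; [apply in_or_app; auto|auto].
Qed.

Lemma app_eq_by_left (A : Type) (P : A -> Prop) (l1 l1' l2 l2' : list A) :
  (forall x, In x l1 -> P x) -> (forall x, In x l1' -> P x) ->
  (forall x, In x l2 -> ~ P x) -> (forall x, In x l2' -> ~ P x) ->
  l1 ++ l2 = l1' ++ l2' -> l1 = l1' /\ l2 = l2'.
Proof.
  revert l1'. induction l1 as [|x l1 IH]; intros [|x' l1'] H1 H1' H2 H2' E; simpl in *.
  - auto.
  - exfalso. apply (H2 x'); [rewrite E; left; reflexivity | auto].
  - exfalso. apply (H2' x); [rewrite <- E; left; reflexivity | auto].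
  - injection E as -> E. destruct (IH l1') as [-> ->]; auto.
Qed.

(** The midpoint separates the leaves of the two subtrees, so the list can be cut there without
    knowing the tree. *)
Lemma leaves_inj T T' lo hi : lo < hi -> leaves T lo hi = leaves T' lo hi -> T = T'.
Proof.
  revert T' lo hi. induction T as [|l IHl r IHr]; intros [|l' r'] lo hi H E.
  - reflexivity.
  - exfalso. apply (f_equal (@length _)) in E. rewrite !length_leaves in E. simpl in E.
    pose proof (nleaves_pos l'); pose proof (nleaves_pos r'); lia.
  - exfalso. apply (f_equal (@length _)) in E. rewrite !length_leaves in E. simpl in E.
    pose proof (nleaves_pos l); pose proof (nleaves_pos r); lia.
  - simpl in E.
    apply (app_eq_by_left _ (fun I => fst I < (lo + hi) / 2)) in E.
    + destruct E as [El Er]. f_equal.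
      * apply (IHl l' lo ((lo + hi) / 2)); [lra|exact El].
      * apply (IHr r' ((lo + hi) / 2) hi); [lra|exact Er].
    + intros [p q] Hi. apply leaves_in_range in Hi; simpl; lra.
    + intros [p q] Hi. apply leaves_in_range in Hi; simpl; lra.
    + intros [p q] Hi Hp. apply leaves_in_range in Hi; simpl in *; lra.
    + intros [p q] Hi Hp. apply leaves_in_range in Hi; simpl in *; lra.
Qed.

Section Words.

Variable X : nat -> R -> R.
Hypothesis X_incr : forall i x y, x < y -> X i x < X i y.
Hypothesis X_surj : forall i y, exists x, X i x = y.
Hypothesis X_rel : forall i n x, (i < n)%nat -> X i (X n x) = X (S n) (X i x).
Variable sg : nat -> R.
Hypothesis sg_incr : forall i, sg i < sg (S i).
Hypothesis X_below : forall i x, x <= sg i -> X (S i) x = x.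
Hypothesis X_above : forall i x, sg i <= x -> X i x = X 0 x.
Hypothesis X_sg : forall i, X 0 (sg i) = sg (S i).

(* [word i T] is the positive word of the binary tree T hung at position i of an
   infinite forest; [spine_word] is its variant in which carets on the rightmost
   branch are trivial. *)
Fixpoint word (i : nat) (T : tree) (x : R) : R :=
  match T with
  | Leaf => x
  | Node l r => word i l (word (S i) r (X i x))
  end.

Fixpoint spine_word (i : nat) (T : tree) (x : R) : R :=
  match T with
  | Leaf => x
  | Node l r => word i l (spine_word (S i) r x)
  end.

(** Each of the [nleaves T - 1] carets of [T] contributes a letter of index below the current index
    of the passing letter, and [X_rel] raises that index by one. *)
Lemma word_shift T m j x : (j < m)%nat ->
  word j T (X m x) = X (m + nleaves T - 1) (word j T x).
Proof.
  revert m j x. induction T as [|l IHl r IHr]; intros m j x H; simpl.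
  - f_equal. lia.
  - pose proof (nleaves_pos l); pose proof (nleaves_pos r).
    rewrite X_rel, IHr, IHl by lia. f_equal. lia.
Qed.

(** The new caret produces a letter deep inside the word; moving it to the outside past the subtrees
    on its left shifts its index by their leaf counts, and the result is the position of the
    leaf. *)
Lemma word_split T i T' j x : split_leaf T i T' ->
  word j T' x = X (i + j) (word j T x).
Proof.
  intros H. revert j x. induction H; intros j x; simpl.
  - reflexivity.
  - apply IHsplit_leaf.
  - pose proof (nleaves_pos l).
    rewrite IHsplit_leaf, word_shift by lia. f_equal. lia.
Qed.

Lemma spine_word_split T i T' j x : split_leaf T i T' -> (S i < nleaves T)%nat ->
  spine_word j T' x = X (i + j) (spine_word j T x).
Proof.
  intros H. revert j x. induction H; intros j x Hi; simpl in *.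
  - lia.
  - apply word_split. assumption.
  - pose proof (nleaves_pos l).
    rewrite IHsplit_leaf, word_shift by lia. f_equal. lia.
Qed.

(** The last leaf ends the rightmost branch, so the new caret lies on that branch and carries no
    letter. *)
Lemma spine_word_split_last T i T' j x : split_leaf T i T' -> S i = nleaves T ->
  spine_word j T' x = spine_word j T x.
Proof.
  intros H. revert j x. induction H; intros j x Hi; simpl in *.
  - reflexivity.
  - pose proof (split_leaf_lt _ _ _ H). pose proof (nleaves_pos r). lia.
  - rewrite IHsplit_leaf; [reflexivity|lia].
Qed.

Lemma word_incr T i x y : x < y -> word i T x < word i T y.
Proof. revert i x y. induction T; simpl; auto. Qed.

Lemma spine_word_incr T i x y : x < y -> spine_word i T x < spine_word i T y.
Proof. revert i x y. induction T; simpl; auto using word_incr. Qed.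

Lemma word_below T i x : x <= sg i -> word (S i) T x = x.
Proof.
  revert i x. induction T as [|l IHl r IHr]; intros i x H; simpl; [reflexivity|].
  rewrite X_below, IHr, IHl; auto. pose proof (sg_incr i). lra.
Qed.

Lemma spine_word_below T i x : x <= sg i -> spine_word (S i) T x = x.
Proof.
  revert i x. induction T as [|l IHl r IHr]; intros i x H; simpl; [reflexivity|].
  rewrite IHr, word_below; auto. pose proof (sg_incr i). lra.
Qed.

Lemma iter_X0_sg n i : Nat.iter n (X 0) (sg i) = sg (n + i).
Proof. induction n; simpl; [reflexivity|]. rewrite IHn. apply X_sg. Qed.

Lemma incr_le (f : R -> R) x y : (forall x y, x < y -> f x < f y) -> x <= y -> f x <= f y.
Proof. intros Hf [H| ->]; [left; auto|right; reflexivity]. Qed.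

Lemma incr_inj (f : R -> R) x y : (forall x y, x < y -> f x < f y) -> f x = f y -> x = y.
Proof.
  intros Hf E. destruct (Rtotal_order x y) as [H|[H|H]]; [|exact H|];
  apply Hf in H; lra.
Qed.

Lemma sg_incr_lt i j : (i < j)%nat -> sg i < sg j.
Proof.
  intros H. induction H; [apply sg_incr|]. pose proof (sg_incr m). lra.
Qed.

Lemma iter_X0_ge n i x : sg i <= x -> sg i <= Nat.iter n (X 0) x.
Proof.
  intros H. induction n; simpl; [exact H|].
  apply Rle_trans with (sg (S i)); [left; apply sg_incr|].
  rewrite <- X_sg. apply incr_le; auto.
Qed.

Lemma iter_add (A : Type) (f : A -> A) m n x :
  Nat.iter m f (Nat.iter n f x) = Nat.iter (m + n) f x.
Proof. induction m; simpl; congruence. Qed.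

(** To the right of [sg i] every letter met acts as [X 0], because [X 0] pushes the point past the
    next threshold before the index grows. Only the number of carets remains visible. *)
Lemma word_above T i x : sg i <= x -> word i T x = Nat.iter (nleaves T - 1) (X 0) x.
Proof.
  revert i x. induction T as [|l IHl r IHr]; intros i x H; simpl; [reflexivity|].
  pose proof (nleaves_pos l); pose proof (nleaves_pos r).
  rewrite X_above by assumption.
  assert (H' : sg (S i) <= X 0 x) by (rewrite <- X_sg; apply incr_le; auto).
  rewrite IHr by assumption. rewrite IHl.
  2:{ apply iter_X0_ge. pose proof (sg_incr i). lra. }
  change (X 0 x) with (Nat.iter 1 (X 0) x).
  rewrite !iter_add. f_equal. lia.
Qed.

(* The orbit point [sg i] reads off the number of leaves, and a word is determined
   by that number above [sg i]; below [sg i] the first factor is invisible. *)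
Lemma word_comp_inj T T' i (V V' : R -> R) :
  (forall x, x <= sg i -> V x = x) -> (forall x, x <= sg i -> V' x = x) ->
  (forall x, word i T (V x) = word i T' (V' x)) ->
  nleaves T = nleaves T' /\ (forall x, word i T x = word i T' x) /\
  (forall x, V x = V' x).
Proof.
  intros HV HV' E.
  assert (Hn : nleaves T = nleaves T').
  { specialize (E (sg i)). rewrite HV, HV', !word_above, !iter_X0_sg in E by lra.
    pose proof (nleaves_pos T); pose proof (nleaves_pos T').
    destruct (lt_eq_lt_dec (nleaves T) (nleaves T')) as [[H1|H1]|H1]; [|exact H1|].
    - pose proof (sg_incr_lt (nleaves T - 1 + i) (nleaves T' - 1 + i)).
      assert (sg (nleaves T - 1 + i) < sg (nleaves T' - 1 + i)) by (apply H2; lia). lra.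
    - pose proof (sg_incr_lt (nleaves T' - 1 + i) (nleaves T - 1 + i)).
      assert (sg (nleaves T' - 1 + i) < sg (nleaves T - 1 + i)) by (apply H2; lia). lra. }
  assert (Hw : forall x, word i T x = word i T' x).
  { intros x. destruct (Rle_dec x (sg i)) as [Hx|Hx].
    - specialize (E x). rewrite HV, HV' in E by assumption. exact E.
    - rewrite !word_above by lra. congruence. }
  split; [exact Hn|]. split; [exact Hw|].
  intros x. specialize (E x). rewrite <- Hw in E.
  eapply incr_inj; [|exact E]. intros. apply word_incr. assumption.
Qed.

Lemma word_inj T T' i : nleaves T = nleaves T' ->
  (forall x, word i T x = word i T' x) -> T = T'.
Proof.
  revert T' i. induction T as [|l IHl r IHr]; intros [|l' r'] i Hn E; simpl in *.
  - reflexivity.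
  - pose proof (nleaves_pos l'); pose proof (nleaves_pos r'); lia.
  - pose proof (nleaves_pos l); pose proof (nleaves_pos r); lia.
  - destruct (word_comp_inj l l' i (word (S i) r) (word (S i) r')) as (Hl & El & Er).
    + apply word_below.
    + apply word_below.
    (* Surjectivity of the root letter [X i] cancels it from both words. *)
    + intros y. destruct (X_surj i y) as [x <-]. apply E.
    + f_equal; [eapply IHl|eapply IHr]; eauto. lia.
Qed.

Lemma spine_word_inj T T' i : nleaves T = nleaves T' ->
  (forall x, spine_word i T x = spine_word i T' x) -> T = T'.
Proof.
  revert T' i. induction T as [|l IHl r IHr]; intros [|l' r'] i Hn E; simpl in *.
  - reflexivity.
  - pose proof (nleaves_pos l'); pose proof (nleaves_pos r'); lia.
  - pose proof (nleaves_pos l); pose proof (nleaves_pos r); lia.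
  - destruct (word_comp_inj l l' i (spine_word (S i) r) (spine_word (S i) r'))
      as (Hl & El & Er).
    + apply spine_word_below.
    + apply spine_word_below.
    + exact E.
    + f_equal; [eapply word_inj|eapply IHr]; eauto. lia.
Qed.

(** Common to [affine_map f] and its transpose, so that a refinement may be led by the domain tree
    or by the range tree of a pair. *)
Definition halving_closed (Q : R * R -> R * R -> Prop) : Prop :=
  forall p q p' q', Q (p, q) (p', q') ->
    Q (p, (p + q) / 2) (p', (p' + q') / 2) /\ Q ((p + q) / 2, q) ((p' + q') / 2, q').

Lemma split_pair Q (h h' : R -> R) T i T' S : halving_closed Q ->
  split_leaf T i T' -> Forall2 Q (leaves T 0 1) (leaves S 0 1) ->
  (forall x, spine_word 0 S (h x) = spine_word 0 T (h' x)) ->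
  exists S', split_leaf S i S' /\ Forall2 Q (leaves T' 0 1) (leaves S' 0 1) /\
    (forall x, spine_word 0 S' (h x) = spine_word 0 T' (h' x)).
Proof.
  intros HQ Hs HF Hw.
  assert (Hn : nleaves T = nleaves S).
  { apply Forall2_length in HF. rewrite !length_leaves in HF. exact HF. }
  pose proof (split_leaf_lt _ _ _ Hs) as Hi.
  destruct (split_leaf_ex S i) as [S' HS']; [lia|].
  exists S'. split; [exact HS'|]. split.
  - destruct (leaves_split _ _ _ 0 1 Hs) as (l1 & p & q & l2 & E & Hl & E').
    destruct (leaves_split _ _ _ 0 1 HS') as (k1 & p' & q' & k2 & F & Hk & F').
    rewrite E, F in HF. rewrite E', F'.
    apply Forall2_app_inv_l in HF as (m1 & m2 & H1 & H2 & Em).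
    assert (Hm : length m1 = length k1) by (apply Forall2_length in H1; congruence).
    assert (Emk : m1 = k1 /\ m2 = (p', q') :: k2).
    { symmetry in Em. clear -Em Hm. revert k1 Em Hm.
      induction m1 as [|z m1 IH]; intros [|y k1] Em Hm; simpl in *; try discriminate.
      - auto.
      - injection Em as -> Em. destruct (IH k1); auto. subst. auto. }
    destruct Emk as [-> ->]. inversion H2; subst.
    destruct (HQ _ _ _ _ H4). apply Forall2_app; [assumption|].
    repeat constructor; assumption.
  (* As the leaf counts agree, the split leaf is last in both trees or in neither: both sides gain
     the letter [X i], or none. *)
  - intros x. destruct (Nat.eq_dec (Datatypes.S i) (nleaves T)) as [Hlast|Hlast].
    + rewrite (spine_word_split_last _ _ _ _ _ HS'), (spine_word_split_last _ _ _ _ _ Hs);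
        auto; congruence.
    + rewrite (spine_word_split _ _ _ _ _ HS'), (spine_word_split _ _ _ _ _ Hs) by lia.
      congruence.
Qed.

Lemma refines_pair Q (h h' : R -> R) T T' S : halving_closed Q ->
  refines T T' -> Forall2 Q (leaves T 0 1) (leaves S 0 1) ->
  (forall x, spine_word 0 S (h x) = spine_word 0 T (h' x)) ->
  exists S', Forall2 Q (leaves T' 0 1) (leaves S' 0 1) /\
    (forall x, spine_word 0 S' (h x) = spine_word 0 T' (h' x)).
Proof.
  intros HQ Hr. revert S. induction Hr as [T|T i T' T'' Hs Hr IH]; intros S HF Hw.
  - eauto.
  - destruct (split_pair Q h h' T i T' S) as (S' & _ & HF' & Hw'); auto.
    eapply IH; eauto.
Qed.

(** * Tree pairs representing elements of F *)

Definition affine_map (f : R -> R) (I J : R * R) : Prop :=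
  forall u, 0 <= u <= 1 ->
    f (fst I + u * (snd I - fst I)) = fst J + u * (snd J - fst J).

Lemma affine_map_halving f : halving_closed (affine_map f).
Proof.
  intros p q p' q' H. unfold affine_map in *. simpl in *. split; intros u Hu.
  - replace (p + u * ((p + q) / 2 - p)) with (p + u / 2 * (q - p)) by field.
    rewrite H by lra. field.
  - replace ((p + q) / 2 + u * (q - (p + q) / 2)) with (p + (1 + u) / 2 * (q - p)) by field.
    rewrite H by lra. field.
Qed.

Lemma affine_map_fun f I J J' : affine_map f I J -> affine_map f I J' -> J = J'.
Proof.
  destruct I as [p q], J as [p' q'], J' as [p'' q'']. unfold affine_map; simpl.
  intros H H'.
  assert (E0 : p' + 0 * (q' - p') = p'' + 0 * (q'' - p'')) by (rewrite <- H, <- H'; lra).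
  assert (E1 : p' + 1 * (q' - p') = p'' + 1 * (q'' - p'')) by (rewrite <- H, <- H'; lra).
  f_equal; lra.
Qed.

Lemma Forall2_fun (A B : Type) (Q : A -> B -> Prop) l m m' :
  (forall x y y', Q x y -> Q x y' -> y = y') ->
  Forall2 Q l m -> Forall2 Q l m' -> m = m'.
Proof.
  intros HQ H. revert m'. induction H; intros m' H'; inversion H'; subst; [reflexivity|].
  f_equal; eauto.
Qed.

Lemma Forall2_trans (A B C : Type) (P : A -> B -> Prop) (Q : B -> C -> Prop)
  (O : A -> C -> Prop) l m n :
  (forall x y z, P x y -> Q y z -> O x z) ->
  Forall2 P l m -> Forall2 Q m n -> Forall2 O l n.
Proof.
  intros HPQ H. revert n. induction H; intros n' H'; inversion H'; subst; constructor; eauto.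
Qed.

(** A tree-pair diagram with domain tree [T] and range tree [S]; the equation says that [h] is the
    word of [T] followed by the inverse of the word of [S]. *)
Definition represents (f h : R -> R) : Prop :=
  exists T S, Forall2 (affine_map f) (leaves T 0 1) (leaves S 0 1) /\
    forall x, spine_word 0 S (h x) = spine_word 0 T x.

Lemma represents_full f h : represents f h ->
  exists N0, forall N, (N0 <= N)%nat -> exists S,
    Forall2 (affine_map f) (leaves (full_tree N) 0 1) (leaves S 0 1) /\
    forall x, spine_word 0 S (h x) = spine_word 0 (full_tree N) x.
Proof.
  intros (T & S & HF & Hw). exists (depth T). intros N HN.
  destruct (refines_pair (affine_map f) h (fun x => x) T (full_tree N) S)
    as (S' & HF' & Hw'); eauto using affine_map_halving, refines_full_tree.
Qed.

(** Over a common full domain tree the range tree is determined by [f], and its word is injective,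
    so it can be cancelled. *)
Lemma represents_unique f h h' : represents f h -> represents f h' -> h = h'.
Proof.
  intros H H'. apply represents_full in H as [N H]. apply represents_full in H' as [N' H'].
  destruct (H (max N N')) as (S & HF & Hw); [lia|].
  destruct (H' (max N N')) as (S' & HF' & Hw'); [lia|].
  assert (S = S') as <-.
  { apply leaves_inj with 0 1; [lra|].
    eapply Forall2_fun; eauto using affine_map_fun. }
  apply functional_extensionality. intros x.
  eapply incr_inj; [|rewrite Hw, Hw'; reflexivity].
  intros. apply spine_word_incr. assumption.
Qed.

(** The middle tree [U] is a full tree deep enough to serve as a domain for [g] and to refine the
    range tree of [f]; the latter refinement is pulled back to the domain of [f] through the
    transposed relation. *)
Lemma represents_comp f g h k : represents f h -> represents g k ->
  represents (fun t => g (f t)) (fun t => k (h t)).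
Proof.
  intros (T & S & HF & Hw) Hg. apply represents_full in Hg as [N Hg].
  destruct (Hg (max N (depth S))) as (S2 & HF2 & Hw2); [lia|].
  set (U := full_tree (max N (depth S))) in *.
  destruct (refines_pair (fun I J => affine_map f J I) (fun x => x) h S U T)
    as (T' & HF' & Hw').
  - intros p q p' q' H. apply affine_map_halving. exact H.
  - apply refines_full_tree. lia.
  - apply Forall2_flip. exact HF.
  - intros x. symmetry. apply Hw.
  - exists T', S2. split.
    + eapply Forall2_trans; [|apply Forall2_flip; exact HF'|exact HF2].
      intros I J K H1 H2 u Hu. rewrite H1, H2; auto.
    + intros x. rewrite Hw2. symmetry. apply Hw'.
Qed.

(** Over a common full domain tree the two range trees have the same word on the image of [h], hence
    everywhere, and a word determines its tree. Both maps then send each leaf affinely to the same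
    interval. *)
Lemma represents_inj f g h : represents f h -> represents g h ->
  (forall y, exists x, h x = y) ->
  forall x, 0 <= x <= 1 -> f x = g x.
Proof.
  intros Hf Hg Hh x Hx.
  apply represents_full in Hf as [N Hf]. apply represents_full in Hg as [N' Hg].
  destruct (Hf (max N N')) as (S & HF & Hw); [lia|].
  destruct (Hg (max N N')) as (S' & HF' & Hw'); [lia|].
  assert (S = S') as <-.
  { apply spine_word_inj with 0%nat.
    - apply Forall2_length in HF. apply Forall2_length in HF'.
      rewrite !length_leaves in *. congruence.
    - intros y. destruct (Hh y) as [z <-]. congruence. }
  destruct (leaves_cover (full_tree (max N N')) 0 1 x Hx) as (p & q & Hin & Hpq).
  assert (Hpq' : p < q) by (apply leaves_in_range in Hin; lra).
  assert (HFF : Forall2 (fun I J => affine_map f I J /\ affine_map g I J)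
            (leaves (full_tree (max N N')) 0 1) (leaves S 0 1)).
  { clear -HF HF'. induction HF; inversion HF'; subst; constructor; auto. }
  assert (HJ : exists J, affine_map f (p, q) J /\ affine_map g (p, q) J).
  { clear -HFF Hin. induction HFF; [destruct Hin|destruct Hin as [->|Hin]; eauto]. }
  destruct HJ as (J & Jf & Jg).
  assert (Hu : 0 <= (x - p) / (q - p) <= 1).
  { split; [apply Rle_mult_inv_pos; lra|]. apply Rmult_le_reg_r with (q - p); [lra|].
    unfold Rdiv. rewrite Rmult_assoc, Rinv_l; lra. }
  specialize (Jf _ Hu). specialize (Jg _ Hu). simpl in *.
  replace (p + (x - p) / (q - p) * (q - p)) with x in * by (field; lra). congruence.
Qed.

End Words.

(** * Dyadic subdivisions and Thompson's group *)

Definition std_interval (lo hi : R) (I : R * R) : Prop :=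
  exists (k : nat) (a : Z), (0 <= a < 2 ^ Z.of_nat k)%Z /\
    fst I = lo + (hi - lo) * (IZR a / 2 ^ k) /\
    snd I = lo + (hi - lo) * ((IZR a + 1) / 2 ^ k).

Fixpoint chain (lo hi : R) (L : list (R * R)) : Prop :=
  match L with
  | [] => lo = hi
  | J :: L => fst J = lo /\ chain (snd J) hi L
  end.

Lemma pow2_pos k : 0 < 2 ^ k.
Proof. apply pow_lt. lra. Qed.

Lemma IZR_pow2 k : IZR (2 ^ Z.of_nat k) = 2 ^ k.
Proof. symmetry. apply pow_IZR. Qed.

Lemma std_interval_bounds lo hi I : lo < hi -> std_interval lo hi I ->
  lo <= fst I /\ fst I < snd I /\ snd I <= hi.
Proof.
  intros H (k & a & [Ha Ha'] & -> & ->).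
  apply IZR_le in Ha. assert (Ha2 : (a + 1 <= 2 ^ Z.of_nat k)%Z) by lia.
  apply IZR_le in Ha2. rewrite plus_IZR, IZR_pow2 in Ha2.
  pose proof (pow2_pos k) as Hk.
  assert (0 <= IZR a / 2 ^ k) by (apply Rle_mult_inv_pos; lra).
  assert (E : (IZR a + 1) / 2 ^ k = IZR a / 2 ^ k + / 2 ^ k) by (field; lra).
  assert (0 < / 2 ^ k) by (apply Rinv_0_lt_compat; lra).
  assert ((IZR a + 1) / 2 ^ k <= 1).
  { apply Rmult_le_reg_r with (2 ^ k); [lra|]. unfold Rdiv.
    rewrite Rmult_assoc, Rinv_l; lra. }
  nra.
Qed.

Lemma std_interval_halves lo hi I : lo < hi -> std_interval lo hi I ->
  I = (lo, hi) \/ std_interval lo ((lo + hi) / 2) I \/ std_interval ((lo + hi) / 2) hi I.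
Proof.
  intros H (k & a & [Ha Ha'] & E1 & E2). destruct k as [|k].
  - left. simpl in *. replace a with 0%Z in * by lia. destruct I; simpl in *. f_equal; lra.
  - right. pose proof (pow2_pos k) as Hk.
    replace (Z.of_nat (S k)) with (Z.of_nat k + 1)%Z in Ha' by lia.
    rewrite Z.pow_add_r in Ha' by lia.
    destruct (Z_lt_le_dec a (2 ^ Z.of_nat k)) as [Hlt|Hle].
    + left. exists k, a. split; [lia|]. rewrite E1, E2. simpl. split; field; lra.
    + right. exists k, (a - 2 ^ Z.of_nat k)%Z. split; [lia|].
      rewrite E1, E2, minus_IZR, IZR_pow2. simpl. split; field; lra.
Qed.

Lemma chain_split lo mid hi L : lo <= mid ->
  (forall I, In I L -> fst I < snd I /\ (snd I <= mid \/ mid <= fst I)) ->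
  chain lo hi L -> mid < hi ->
  exists L1 L2, L = L1 ++ L2 /\ chain lo mid L1 /\ chain mid hi L2.
Proof.
  revert lo. induction L as [|I L IH]; intros lo H HI Hc Hm; simpl in Hc.
  - lra.
  - destruct Hc as [E Hc]. destruct (Req_dec lo mid) as [<-|Hne].
    + exists [], (I :: L). simpl. auto.
    + destruct (HI I) as [H1 H2]; [left; reflexivity|].
      destruct (IH (snd I)) as (L1 & L2 & -> & C1 & C2); auto.
      * destruct H2; lra.
      * intros; apply HI; right; assumption.
      * exists (I :: L1), L2. simpl. auto.
Qed.

Lemma chain_bounds lo hi L I : (forall I, In I L -> fst I < snd I) -> chain lo hi L ->
  In I L -> lo <= fst I /\ snd I <= hi.
Proof.
  intros HL Hc Hin. split.
  - revert lo Hc. induction L as [|J L IH]; intros lo Hc; [destruct Hin|].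
    destruct Hc as [E Hc]. destruct Hin as [->|Hin]; [lra|].
    assert (snd J <= fst I).
    { apply IH; auto. intros; apply HL; right; assumption. }
    specialize (HL J (or_introl eq_refl)). lra.
  - revert lo Hc Hin. induction L as [|J L IH]; intros lo Hc Hin; [destruct Hin|].
    destruct Hc as [E Hc].
    assert (HL' : forall I, In I L -> fst I < snd I) by (intros; apply HL; right; assumption).
    destruct Hin as [->|Hin]; [|eauto].
    clear -Hc HL'. revert Hc. generalize (snd I). induction L as [|J L IH]; intros x Hc.
    + simpl in Hc. lra.
    + destruct Hc as [E Hc]. specialize (IH (fun I H => HL' I (or_intror H)) _ Hc).
      specialize (HL' J (or_introl eq_refl)). lra.
Qed.

(** If the whole interval belongs to the chain it is its only member. Otherwise no member straddles
    the midpoint, and the chain falls into two nonempty, hence shorter, chains over the halves. *)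
Lemma std_chain_is_tree n L lo hi : (length L <= n)%nat -> lo < hi ->
  (forall I, In I L -> std_interval lo hi I) -> chain lo hi L ->
  exists T, leaves T lo hi = L.
Proof.
  revert L lo hi. induction n as [|n IH]; intros L lo hi Hn Hlt HL Hc.
  - destruct L; simpl in *; [lra|lia].
  - assert (HL' : forall I, In I L -> fst I < snd I).
    { intros I HI. apply HL in HI. apply std_interval_bounds in HI; lra. }
    destruct (classic (In (lo, hi) L)) as [Hin|Hnin].
    + exists Leaf. simpl. destruct L as [|I L]; [destruct Hin|].
      assert (HI : I = (lo, hi)).
      { destruct Hin as [Hin|Hin]; [auto|]. destruct Hc as [E Hc].
        apply (chain_bounds (snd I) hi L) in Hin as [Hin _];
          [|intros; apply HL'; right; assumption|assumption].
        specialize (HL' I (or_introl eq_refl)). simpl in Hin. lra. }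
      subst I. f_equal. destruct L as [|J L]; [reflexivity|].
      destruct Hc as [_ [E _]]. simpl in E.
      assert (HJ : std_interval lo hi J) by (apply HL; simpl; auto).
      apply std_interval_bounds in HJ; lra.
    + set (mid := (lo + hi) / 2) in *.
      assert (Hmid : lo < mid < hi) by (unfold mid; lra).
      assert (Hh : forall I, In I L -> std_interval lo mid I \/ std_interval mid hi I).
      { intros I HI. destruct (std_interval_halves lo hi I) as [->|Hs]; auto. contradiction. }
      destruct (chain_split lo mid hi L) as (L1 & L2 & -> & C1 & C2); auto; try lra.
      { intros I HI. split; [auto|].
        destruct (Hh I HI) as [Hs|Hs]; apply std_interval_bounds in Hs; lra. }
      assert (H1 : (1 <= length L1)%nat) by (destruct L1; simpl in *; [lra|lia]).
      assert (H2 : (1 <= length L2)%nat) by (destruct L2; simpl in *; [lra|lia]).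
      rewrite length_app in Hn.
      destruct (IH L1 lo mid) as [T1 E1]; [lia|lra| |assumption|].
      { intros I HI. destruct (Hh I) as [Hs|Hs]; [apply in_or_app; auto|exact Hs|].
        exfalso. apply (chain_bounds lo mid L1) in HI; auto.
        - apply std_interval_bounds in Hs; lra.
        - intros; apply HL'; apply in_or_app; auto. }
      destruct (IH L2 mid hi) as [T2 E2]; [lia|lra| |assumption|].
      { intros I HI. destruct (Hh I) as [Hs|Hs]; [apply in_or_app; auto| |exact Hs].
        exfalso. apply (chain_bounds mid hi L2) in HI; auto.
        - apply std_interval_bounds in Hs; lra.
        - intros; apply HL'; apply in_or_app; auto. }
      exists (Node T1 T2). simpl. fold mid. congruence.
Qed.

Lemma chain_app lo mid hi L1 L2 :
  chain lo mid L1 -> chain mid hi L2 -> chain lo hi (L1 ++ L2).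
Proof.
  revert lo. induction L1 as [|I L1 IH]; intros lo H1 H2; simpl in *.
  - subst. assumption.
  - destruct H1. auto.
Qed.

Lemma chain_leaves T lo hi : chain lo hi (leaves T lo hi).
Proof.
  revert lo hi. induction T; intros; simpl; [auto|]. eapply chain_app; eauto.
Qed.

Lemma chain_map (f : R -> R) lo hi L : chain lo hi L ->
  chain (f lo) (f hi) (map (fun I => (f (fst I), f (snd I))) L).
Proof.
  revert lo. induction L as [|I L IH]; intros lo H; simpl in *; [congruence|].
  destruct H as [<- H]. auto.
Qed.

Lemma leaves_full_tree N lo hi I : In I (leaves (full_tree N) lo hi) ->
  exists j : Z, (0 <= j < 2 ^ Z.of_nat N)%Z /\
    fst I = lo + (hi - lo) * (IZR j / 2 ^ N) /\
    snd I = lo + (hi - lo) * ((IZR j + 1) / 2 ^ N).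
Proof.
  revert lo hi. induction N as [|N IH]; intros lo hi H; simpl in H.
  - destruct H as [<-|[]]. exists 0%Z. simpl. split; [lia|]. lra.
  - pose proof (pow2_pos N). replace (Z.of_nat (S N)) with (Z.of_nat N + 1)%Z by lia.
    rewrite Z.pow_add_r by lia. change (2 ^ 1)%Z with 2%Z.
    apply in_app_or in H as [Hin|Hin]; apply IH in Hin as (j & Hj & -> & ->).
    + exists j. split; [lia|]. simpl. split; field; lra.
    + exists (j + 2 ^ Z.of_nat N)%Z. split; [lia|].
      rewrite plus_IZR, IZR_pow2. simpl. split; field; lra.
Qed.

Lemma dyadic_eventually x : dyadic x ->
  exists K : nat, forall N, (K <= N)%nat -> exists A : Z, x = IZR A / 2 ^ N.
Proof.
  intros (a & k & ->). exists k. intros N HN.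
  exists (a * 2 ^ Z.of_nat (N - k))%Z. rewrite mult_IZR, IZR_pow2.
  replace (2 ^ N) with (2 ^ (N - k) * 2 ^ k) by (rewrite <- pow_add; f_equal; lia).
  field. split; apply Rgt_not_eq, pow2_pos.
Qed.

Lemma dyadic_plus x y : dyadic x -> dyadic y -> dyadic (x + y).
Proof.
  intros Hx Hy. apply dyadic_eventually in Hx as [K HK].
  apply dyadic_eventually in Hy as [K' HK'].
  destruct (HK (max K K')) as [A ->]; [lia|]. destruct (HK' (max K K')) as [B ->]; [lia|].
  exists (A + B)%Z, (max K K'). rewrite plus_IZR. field. apply Rgt_not_eq, pow2_pos.
Qed.

Lemma dyadic_opp x : dyadic x -> dyadic (- x).
Proof.
  intros (a & k & ->). exists (- a)%Z, k. rewrite opp_IZR. field. apply Rgt_not_eq, pow2_pos.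
Qed.

Lemma dyadic_mult_pow2 x z : dyadic x -> dyadic (powerRZ 2 z * x).
Proof.
  intros (a & k & ->). destruct (Z_le_gt_dec 0 z) as [Hz|Hz].
  - exists (2 ^ z * a)%Z, k. rewrite mult_IZR.
    replace z with (Z.of_nat (Z.to_nat z)) by lia.
    rewrite IZR_pow2, <- pow_powerRZ. field. apply Rgt_not_eq, pow2_pos.
  - exists a, (k + Z.to_nat (- z))%nat.
    replace z with (- Z.of_nat (Z.to_nat (- z)))%Z at 1 by lia.
    rewrite powerRZ_neg', <- pow_powerRZ, pow_add. field.
    split; apply Rgt_not_eq, pow2_pos.
Qed.

(** A slope [2 ^ z] carries the grid of mesh [2 ^ -N] to one of mesh [2 ^ -k]; the bound [K] is
    there to make that mesh fine enough to contain the translation constant of the affine piece. *)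
Lemma pow2_scale z K : exists K' : nat, forall N, (K' <= N)%nat ->
  exists k : nat, (K <= k)%nat /\ powerRZ 2 z / 2 ^ N = / 2 ^ k.
Proof.
  exists (K + Z.to_nat (Z.abs z))%nat. intros N HN.
  exists (Z.to_nat (Z.of_nat N - z)). split; [lia|].
  rewrite !pow_powerRZ, Z2Nat.id by lia.
  unfold Rdiv. rewrite <- !powerRZ_neg', <- powerRZ_add by lra.
  f_equal. lia.
Qed.

Lemma eventually_all_lt (P : nat -> nat -> Prop) k :
  (forall i, (i < k)%nat -> exists K, forall N, (K <= N)%nat -> P i N) ->
  exists K, forall N, (K <= N)%nat -> forall i, (i < k)%nat -> P i N.
Proof.
  induction k as [|k IH]; intros H.
  - exists 0%nat. intros; lia.
  - destruct IH as [K HK]; [intros; apply H; lia|].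
    destruct (H k) as [K' HK']; [lia|].
    exists (max K K'). intros N HN i Hi.
    destruct (Nat.eq_dec i k) as [->|]; [apply HK'|apply HK]; lia.
Qed.

Lemma find_piece (b : nat -> R) k x : b 0%nat <= x < b k ->
  exists i, (i < k)%nat /\ b i <= x < b (S i).
Proof.
  induction k as [|k IH]; intros H; [lra|].
  destruct (Rlt_dec x (b k)) as [Hx|Hx].
  - destruct IH as (i & Hi & Hb); [lra|]. exists i. split; [lia|assumption].
  - exists k. split; [lia|lra].
Qed.

(** On a fine enough grid every breakpoint is a grid point and every piece maps grid intervals onto
    standard dyadic ones. The images form a chain, and such a chain is the leaf list of a tree. *)
Lemma thompson_full_tree f : ThompsonF f ->
  exists N S, Forall2 (affine_map f) (leaves (full_tree N) 0 1) (leaves S 0 1).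
Proof.
  intros ((Hout & H0 & H1 & Hinc & _) & k & b & Hb0 & Hbk & Hb & Hd & Haff).
  assert (Hle : forall x y, 0 <= x -> x <= y -> y <= 1 -> f x <= f y).
  { intros x y ? [?| ->] ?; [left; auto|right; reflexivity]. }
  (* The definition of F leaves the constants [c] arbitrary reals; they turn out dyadic because the
     values at breakpoints are, inductively from [f 0 = 0]. *)
  assert (Hfd : forall i, (i <= k)%nat -> dyadic (f (b i))).
  { induction i as [|i IH]; intros Hi.
    - rewrite Hb0, H0. exists 0%Z, 0%nat. simpl. lra.
    - destruct (Haff i) as (z & c & E); [lia|].
      assert (Hbi : b i < b (S i)) by (apply Hb; lia).
      rewrite E by lra.
      replace (powerRZ 2 z * b (S i) + c)
        with (f (b i) + powerRZ 2 z * (b (S i) + - b i)) by (rewrite (E (b i)); [ring|lra]).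
      apply dyadic_plus; [apply IH; lia|]. apply dyadic_mult_pow2.
      apply dyadic_plus; [apply Hd; lia|apply dyadic_opp, Hd; lia]. }
  destruct (eventually_all_lt (fun i N => (exists B, b (S i) = IZR B / 2 ^ N) /\
     exists z c m C, (forall t, b i <= t <= b (S i) -> f t = powerRZ 2 z * t + c) /\
       powerRZ 2 z / 2 ^ N = / 2 ^ m /\ c = IZR C / 2 ^ m) k) as [N HN].
  { intros i Hi. destruct (Haff i Hi) as (z & c & E).
    assert (Hbi : b i < b (S i)) by (apply Hb; lia).
    assert (Hc : dyadic c).
    { replace c with (f (b i) + - (powerRZ 2 z * b i)) by (rewrite E by lra; ring).
      apply dyadic_plus; [apply Hfd; lia|].
      apply dyadic_opp, dyadic_mult_pow2, Hd. lia. }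
    apply dyadic_eventually in Hc as [Kc HKc].
    destruct (dyadic_eventually (b (S i))) as [Kb HKb]; [apply Hd; lia|].
    destruct (pow2_scale z Kc) as [Kz HKz].
    exists (max Kb Kz). intros N HN. split; [apply HKb; lia|].
    destruct (HKz N) as (m & Hm & Em); [lia|].
    destruct (HKc m Hm) as [C HC]. exists z, c, m, C. auto. }
  specialize (HN N (le_n N)). exists N.
  assert (key : forall I, In I (leaves (full_tree N) 0 1) ->
    std_interval 0 1 (f (fst I), f (snd I)) /\ affine_map f I (f (fst I), f (snd I))).
  { intros I HI. assert (Hr : 0 <= fst I /\ fst I < snd I /\ snd I <= 1).
    { destruct I. apply leaves_in_range in HI; simpl; lra. }
    apply leaves_full_tree in HI as (j & Hj & Ep & Eq).
    pose proof (pow2_pos N) as HposN.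
    assert (Ep' : fst I = IZR j / 2 ^ N) by lra.
    assert (Eq' : snd I = (IZR j + 1) / 2 ^ N) by lra.
    destruct (find_piece b k (fst I)) as (i & Hi & Hbi); [lra|].
    destruct (HN i Hi) as [[B HB] (z & c & m & C & E & Em & EC)].
    pose proof (pow2_pos m) as Hposm.
    (* Since [b (S i)] is a grid point to the right of [fst I], the interval [I] does not cross
       it. *)
    assert (HjB : (j + 1 <= B)%Z).
    { enough (j < B)%Z by lia. apply lt_IZR.
      apply Rmult_lt_reg_r with (/ 2 ^ N); [apply Rinv_0_lt_compat; lra|].
      unfold Rdiv in *. lra. }
    assert (Hq : snd I <= b (S i)).
    { rewrite HB, Eq'. apply Rmult_le_compat_r; [left; apply Rinv_0_lt_compat; lra|].
      rewrite <- plus_IZR. apply IZR_le. exact HjB. }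
    assert (Fp : f (fst I) = (IZR j + IZR C) / 2 ^ m).
    { rewrite E by lra. rewrite Ep', EC.
      replace (powerRZ 2 z * (IZR j / 2 ^ N)) with (IZR j * (powerRZ 2 z / 2 ^ N))
        by (field; lra). rewrite Em. field. lra. }
    assert (Fq : f (snd I) = (IZR j + IZR C + 1) / 2 ^ m).
    { rewrite E by lra. rewrite Eq', EC.
      replace (powerRZ 2 z * ((IZR j + 1) / 2 ^ N))
        with ((IZR j + 1) * (powerRZ 2 z / 2 ^ N)) by (field; lra).
      rewrite Em. field. lra. }
    split.
    - exists m, (j + C)%Z. simpl. rewrite plus_IZR. split; [|rewrite Fp, Fq; lra].
      assert (G0 : 0 <= f (fst I)) by (rewrite <- H0; apply Hle; lra).
      assert (G1 : f (snd I) <= 1) by (rewrite <- H1; apply Hle; lra).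
      rewrite Fp in G0. rewrite Fq in G1. split.
      + apply le_IZR. rewrite plus_IZR. apply Rmult_le_reg_r with (/ 2 ^ m);
          [apply Rinv_0_lt_compat; lra|]. unfold Rdiv in G0. lra.
      + enough (j + C + 1 <= 2 ^ Z.of_nat m)%Z by lia.
        apply le_IZR. rewrite !plus_IZR, IZR_pow2.
        apply Rmult_le_reg_r with (/ 2 ^ m); [apply Rinv_0_lt_compat; lra|].
        rewrite Rinv_r by lra. exact G1.
    - intros u Hu. simpl.
      assert (0 <= u * (snd I - fst I) <= snd I - fst I) by nra.
      rewrite !E by lra. ring. }
  destruct (std_chain_is_tree
    (length (map (fun I => (f (fst I), f (snd I))) (leaves (full_tree N) 0 1)))
    (map (fun I => (f (fst I), f (snd I))) (leaves (full_tree N) 0 1)) 0 1)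
    as [S HS]; [lia|lra| | |].
  - intros J HJ. apply in_map_iff in HJ as (I & <- & HI). apply key, HI.
  - rewrite <- H0 at 1. rewrite <- H1 at 1. apply chain_map, chain_leaves.
  - exists S. rewrite HS. clear HS.
    induction (leaves (full_tree N) 0 1) as [|I L IH]; simpl; constructor.
    + apply key. left. reflexivity.
    + apply IH. intros; apply key; right; assumption.
Qed.

(** * Thompson's group from two homeomorphisms *)

Definition incr_group (G : (R -> R) -> Prop) : Prop :=
  G (fun t => t) /\
  (forall f g, G f -> G g -> G (fun t => g (f t))) /\
  (forall f, G f -> exists h, G h /\ (forall t, h (f t) = t) /\ (forall t, f (h t) = t)) /\
  (forall f, G f -> forall x y, x < y -> f x < f y).

Section ThompsonSubgroup.

Variable G : (R -> R) -> Prop.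
Hypothesis HG : incr_group G.
Variables (x0 y0 x1 : R -> R) (s t : R).
Hypothesis Gx0 : G x0.
Hypothesis Gy0 : G y0.
Hypothesis Gx1 : G x1.
Hypothesis y0x0 : forall x, y0 (x0 x) = x.
Hypothesis x0y0 : forall x, x0 (y0 x) = x.
Hypothesis Hst : s < t.
Hypothesis x1_id : forall x, x <= s -> x1 x = x.
Hypothesis x01 : forall x, t <= x -> x0 x = x1 x.
Hypothesis x0s : t <= x0 s.

Fixpoint Xseq (n : nat) : R -> R :=
  match n with
  | O => x0
  | S O => x1
  | S (S _ as m) => fun x => x0 (Xseq m (y0 x))
  end.

(** Thresholds of the letters: [Xseq (S n)] is trivial up to [sgseq n] and agrees with [x0] from
    [sgseq (S n)] on. For [n = 0] the latter is the hypothesis [t <= x0 s]. *)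
Definition sgseq (n : nat) : R := Nat.iter n x0 s.

Lemma Xseq_SS n x : Xseq (S (S n)) x = x0 (Xseq (S n) (y0 x)).
Proof. reflexivity. Qed.

Lemma G_incr f : G f -> forall x y, x < y -> f x < f y.
Proof. destruct HG as (_ & _ & _ & H). exact (H f). Qed.

Lemma x0_incr x y : x < y -> x0 x < x0 y.
Proof. exact (G_incr x0 Gx0 x y). Qed.

Lemma y0_incr x y : x < y -> y0 x < y0 y.
Proof. exact (G_incr y0 Gy0 x y). Qed.

Lemma Xseq_G n : G (Xseq n).
Proof.
  destruct HG as (_ & Hmul & _).
  induction n as [|[|n] IH]; [exact Gx0|exact Gx1|].
  apply (Hmul (fun x => Xseq (S n) (y0 x)) x0); [|exact Gx0].
  apply (Hmul y0 (Xseq (S n))); assumption.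
Qed.

Lemma Xseq_incr n x y : x < y -> Xseq n x < Xseq n y.
Proof. exact (G_incr _ (Xseq_G n) x y). Qed.

Lemma G_surj f : G f -> forall y, exists x, f x = y.
Proof.
  intros Hf y. destruct HG as (_ & _ & Hinv & _).
  destruct (Hinv f Hf) as (h & _ & _ & E). eauto.
Qed.

Lemma sgseq_incr n : sgseq n < sgseq (S n).
Proof.
  induction n as [|n IH]; simpl; [|apply x0_incr; exact IH].
  pose proof x0s. unfold sgseq. simpl. lra.
Qed.

Lemma y0_le x y : x <= x0 y -> y0 x <= y.
Proof.
  intros H. rewrite <- (y0x0 y). apply incr_le; [apply y0_incr|exact H].
Qed.

Lemma y0_ge x y : x0 y <= x -> y <= y0 x.
Proof.
  intros H. rewrite <- (y0x0 y). apply incr_le; [apply y0_incr|exact H].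
Qed.

Lemma Xseq_below n x : x <= sgseq n -> Xseq (S n) x = x.
Proof.
  revert x. induction n as [|n IH]; intros x H; [apply x1_id; exact H|].
  rewrite Xseq_SS, IH; [apply x0y0|]. apply y0_le. exact H.
Qed.

Lemma sgseq_ge_1 n : sgseq 1 <= sgseq (S n).
Proof.
  induction n as [|n IH]; [lra|]. pose proof (sgseq_incr (S n)). lra.
Qed.

Lemma Xseq_above n x : sgseq n <= x -> Xseq n x = x0 x.
Proof.
  revert x. induction n as [|[|n] IH]; intros x H.
  - reflexivity.
  - symmetry. apply x01. apply Rle_trans with (sgseq 1); [exact x0s|exact H].
  - rewrite Xseq_SS, IH; [rewrite x0y0; reflexivity|]. apply y0_ge. exact H.
Qed.

(** For [i = 0] this is the definition by conjugation, and [i >= 2] reduces to [i - 1] by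
    conjugating with [x0]. For [i = 1] the line is cut at a threshold: on its left both letters of
    larger index act trivially, on its right [x1] acts as [x0], which is the case [i = 0]. *)
Lemma Xseq_rel i n x : (i < n)%nat -> Xseq i (Xseq n x) = Xseq (S n) (Xseq i x).
Proof.
  revert n x. induction i as [|i IH]; intros [|n] x Hin; try lia.
  - rewrite Xseq_SS. change (Xseq 0) with x0. rewrite y0x0. reflexivity.
  - destruct i as [|i].
    + destruct (Rle_dec x (sgseq n)) as [Hx|Hx].
      * rewrite (Xseq_below n x) by assumption. rewrite (Xseq_below (S n)); [reflexivity|].
        destruct n as [|n]; [lia|]. change (sgseq (S (S n))) with (x0 (sgseq (S n))).
        rewrite <- (Xseq_above 1 (sgseq (S n))).
        -- apply incr_le; [apply Xseq_incr|exact Hx].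
        -- apply sgseq_ge_1.
      * destruct n as [|n]; [lia|].
        pose proof (sgseq_ge_1 n) as H1.
        assert (H2 : sgseq (S n) <= Xseq (S (S n)) x).
        { rewrite <- (Xseq_below (S n) (sgseq (S n))) by lra.
          apply incr_le; [apply Xseq_incr|lra]. }
        rewrite !(Xseq_above 1) by lra. rewrite (Xseq_SS (S n)), y0x0. reflexivity.
    + destruct n as [|n]; [lia|].
      rewrite (Xseq_SS n x), (Xseq_SS i x), (Xseq_SS i (x0 _)), (Xseq_SS (S n)), !y0x0.
      rewrite IH by lia. reflexivity.
Qed.

Lemma spine_word_G i T : G (spine_word Xseq i T).
Proof.
  destruct HG as (Hid & Hmul & _).
  assert (Hw : forall T i, G (word Xseq i T)).
  { induction T0 as [|l IHl r IHr]; intros j; [exact Hid|].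
    apply (Hmul (fun x => word Xseq (S j) r (Xseq j x)) (word Xseq j l)); [|apply IHl].
    apply (Hmul (Xseq j) (word Xseq (S j) r)); [apply Xseq_G|apply IHr]. }
  revert i. induction T as [|l IHl r IHr]; intros j; [exact Hid|].
  apply (Hmul (spine_word Xseq (S j) r) (word Xseq j l)); [apply IHr|apply Hw].
Qed.

Lemma thompson_represents f : ThompsonF f -> exists h, G h /\ represents Xseq f h.
Proof.
  intros Hf. destruct (thompson_full_tree f Hf) as (N & S & HF).
  pose proof HG as (_ & Hmul & Hinv & _).
  destruct (Hinv _ (spine_word_G 0 S)) as (k & Gk & _ & Ek).
  exists (fun x => k (spine_word Xseq 0 (full_tree N) x)). split.
  - apply (Hmul (spine_word Xseq 0 (full_tree N)) k); [apply spine_word_G|exact Gk].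
  - exists (full_tree N), S. auto.
Qed.

Lemma contains_F_of_generators : contains_F G.
Proof.
  pose (phi := fun f => epsilon (inhabits (fun x : R => x))
                 (fun h => G h /\ represents Xseq f h)).
  assert (Hphi : forall f, ThompsonF f -> G (phi f) /\ represents Xseq f (phi f)).
  { intros f Hf. unfold phi. apply epsilon_spec. exact (thompson_represents f Hf). }
  assert (Hcomp : forall f g, ThompsonF f -> ThompsonF g ->
    represents Xseq (fun t => g (f t)) (fun t => phi g (phi f t))).
  { intros f g Hf Hg. apply represents_comp.
    - exact Xseq_rel.
    - exact (proj2 (Hphi f Hf)).
    - exact (proj2 (Hphi g Hg)). }
  exists phi. split; [intros f Hf; exact (proj1 (Hphi f Hf))|]. split.
  - intros f g Hf Hg.
    (* The product of the two images witnesses that the choice made by [epsilon] at the composite is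
       a genuine one. *)
    assert (Hex : represents Xseq (fun t => g (f t)) (phi (fun t => g (f t)))).
    { refine (proj2 (epsilon_spec (inhabits (fun x : R => x))
        (fun h => G h /\ represents Xseq (fun t => g (f t)) h) _)).
      exists (fun t => phi g (phi f t)). split; [|apply Hcomp; assumption].
      destruct HG as (_ & Hmul & _). apply Hmul; apply Hphi; assumption. }
    eapply represents_unique; [exact Xseq_incr|exact Xseq_rel|exact Hex|].
    apply Hcomp; assumption.
  - intros f g Hf Hg E. apply functional_extensionality. intros x.
    destruct (classic (0 <= x <= 1)) as [Hx|Hx].
    + eapply (represents_inj Xseq Xseq_incr) with (sg := sgseq) (h := phi f).
      * intros i. apply G_surj, Xseq_G.
      * exact Xseq_rel.
      * exact sgseq_incr.
      * exact Xseq_below.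
      * exact Xseq_above.
      * reflexivity.
      * exact (proj2 (Hphi f Hf)).
      * rewrite E. exact (proj2 (Hphi g Hg)).
      * exact (G_surj _ (proj1 (Hphi f Hf))).
      * exact Hx.
    + destruct Hf as ((Hf & _) & _). destruct Hg as ((Hg & _) & _).
      rewrite Hf, Hg by lra. reflexivity.
Qed.

End ThompsonSubgroup.

Lemma contains_F_of_pair (G : (R -> R) -> Prop) (x0 x1 : R -> R) (s t : R) :
  incr_group G -> G x0 -> G x1 -> s < t ->
  (forall x, x <= s -> x1 x = x) -> (forall x, t <= x -> x0 x = x1 x) -> t <= x0 s ->
  contains_F G.
Proof.
  intros HG H0 H1 Hst Hid H01 Hs. pose proof HG as (_ & _ & Hinv & _).
  destruct (Hinv x0 H0) as (y0 & Gy0 & E1 & E2).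
  exact (contains_F_of_generators G HG x0 y0 x1 s t H0 Gy0 H1 E1 E2 Hst Hid H01 Hs).
Qed.

(** * Piecewise linear homeomorphisms *)

Definition affine_right (f : R -> R) (p m e : R) : Prop :=
  0 < e /\ forall x, p <= x <= p + e -> f x = f p + m * (x - p).

Definition affine_left (f : R -> R) (p m e : R) : Prop :=
  0 < e /\ forall x, p - e <= x <= p -> f x = f p + m * (x - p).

(** One-sided affine germs pass to composites and inverses without merging lists of breakpoints;
    finiteness is recovered by compactness where it matters. *)
Definition locally_PL (f : R -> R) : Prop :=
  forall p, (exists m e, affine_right f p m e) /\ (exists m e, affine_left f p m e).

Definition strictly_incr (f : R -> R) : Prop := forall x y, x < y -> f x < f y.

Definition PL_homeo (f : R -> R) : Prop :=
  strictly_incr f /\ (forall y, exists x, f x = y) /\ locally_PL f /\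
  (forall t, t < 0 \/ 1 < t -> f t = t).

Lemma affine_right_pos f p m e : strictly_incr f -> affine_right f p m e -> 0 < m.
Proof.
  intros Hf [He H]. specialize (H (p + e)). specialize (Hf p (p + e)).
  assert (f (p + e) = f p + m * (p + e - p)) by (apply H; lra).
  assert (f p < f (p + e)) by (apply Hf; lra). nra.
Qed.

Lemma affine_left_pos f p m e : strictly_incr f -> affine_left f p m e -> 0 < m.
Proof.
  intros Hf [He H]. specialize (H (p - e)). specialize (Hf (p - e) p).
  assert (f (p - e) = f p + m * (p - e - p)) by (apply H; lra).
  assert (f (p - e) < f p) by (apply Hf; lra). nra.
Qed.

Lemma affine_right_comp f g p m e n d : strictly_incr f ->
  affine_right f p m e -> affine_right g (f p) n d ->
  exists c, affine_right (fun t => g (f t)) p (n * m) c.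
Proof.
  intros Hf H [Hd Hg]. pose proof (affine_right_pos f p m e Hf H) as Hm.
  destruct H as [He H]. exists (Rmin e (d / m)).
  assert (0 < d / m) by (apply Rdiv_lt_0_compat; lra).
  split; [apply Rmin_glb_lt; lra|]. intros x Hx.
  pose proof (Rmin_l e (d / m)). pose proof (Rmin_r e (d / m)).
  assert (Hxm : m * (x - p) <= d).
  { apply Rle_trans with (m * (d / m)); [apply Rmult_le_compat_l; lra|].
    right. field. lra. }
  rewrite H by lra. rewrite Hg by nra. ring.
Qed.

Lemma affine_left_comp f g p m e n d : strictly_incr f ->
  affine_left f p m e -> affine_left g (f p) n d ->
  exists c, affine_left (fun t => g (f t)) p (n * m) c.
Proof.
  intros Hf H [Hd Hg]. pose proof (affine_left_pos f p m e Hf H) as Hm.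
  destruct H as [He H]. exists (Rmin e (d / m)).
  assert (0 < d / m) by (apply Rdiv_lt_0_compat; lra).
  split; [apply Rmin_glb_lt; lra|]. intros x Hx.
  pose proof (Rmin_l e (d / m)). pose proof (Rmin_r e (d / m)).
  assert (Hxm : m * (p - x) <= d).
  { apply Rle_trans with (m * (d / m)); [apply Rmult_le_compat_l; lra|].
    right. field. lra. }
  rewrite H by lra. rewrite Hg by nra. ring.
Qed.

Lemma affine_right_inv f h q m e : strictly_incr f -> (forall t, h (f t) = t) ->
  affine_right f q m e -> affine_right h (f q) (/ m) (m * e).
Proof.
  intros Hf Hh H. pose proof (affine_right_pos f q m e Hf H) as Hm.
  destruct H as [He H]. split; [nra|]. intros y Hy. rewrite Hh.
  assert (Hi : 0 < / m) by (apply Rinv_0_lt_compat; lra).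
  assert (Hb : 0 <= / m * (y - f q) <= e).
  { split; [apply Rmult_le_pos; lra|].
    apply Rle_trans with (/ m * (m * e)); [apply Rmult_le_compat_l; lra|].
    right. field. lra. }
  rewrite <- (Hh (q + / m * (y - f q))). f_equal. rewrite H by lra. field. lra.
Qed.

Lemma affine_left_inv f h q m e : strictly_incr f -> (forall t, h (f t) = t) ->
  affine_left f q m e -> affine_left h (f q) (/ m) (m * e).
Proof.
  intros Hf Hh H. pose proof (affine_left_pos f q m e Hf H) as Hm.
  destruct H as [He H]. split; [nra|]. intros y Hy. rewrite Hh.
  assert (Hi : 0 < / m) by (apply Rinv_0_lt_compat; lra).
  assert (Hb : 0 <= / m * (f q - y) <= e).
  { split; [apply Rmult_le_pos; lra|].
    apply Rle_trans with (/ m * (m * e)); [apply Rmult_le_compat_l; lra|].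
    right. field. lra. }
  rewrite <- (Hh (q + / m * (y - f q))). f_equal. rewrite H by lra. field. lra.
Qed.

Lemma inverse_increasing f h : strictly_incr f -> (forall t, f (h t) = t) -> strictly_incr h.
Proof.
  intros Hf Hh x y Hxy. destruct (Rlt_le_dec (h x) (h y)) as [H|H]; [exact H|].
  apply (incr_le f) in H; [|exact Hf]. rewrite !Hh in H. lra.
Qed.

Lemma PL_homeo_id : PL_homeo (fun t => t).
Proof.
  split; [intros x y H; exact H|]. split; [intros y; exists y; reflexivity|].
  split; [|reflexivity].
  intros p. split; exists 1, 1; (split; [lra|]); intros x Hx; ring.
Qed.

Lemma PL_homeo_comp f g : PL_homeo f -> PL_homeo g -> PL_homeo (fun t => g (f t)).
Proof.
  intros (If & Sf & Lf & Of) (Ig & Sg & Lg & Og). split.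
  { intros x y H. apply Ig, If, H. }
  split.
  { intros y. destruct (Sg y) as [z <-]. destruct (Sf z) as [x <-]. exists x. reflexivity. }
  split.
  - intros p. destruct (Lf p) as [(m & e & H) (m' & e' & H')].
    destruct (Lg (f p)) as [(n & d & K) (n' & d' & K')]. split.
    + destruct (affine_right_comp f g p m e n d If H K) as [c Hc]. exists (n * m), c. exact Hc.
    + destruct (affine_left_comp f g p m' e' n' d' If H' K') as [c Hc].
      exists (n' * m'), c. exact Hc.
  - intros t Ht. rewrite Of, Og; auto.
Qed.

Lemma PL_homeo_inv f h : (forall t, h (f t) = t) -> (forall t, f (h t) = t) ->
  PL_homeo f -> PL_homeo h.
Proof.
  intros H1 H2 (If & Sf & Lf & Of). split.
  { eapply inverse_increasing; eauto. }
  split.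
  { intros y. exists (f y). apply H1. }
  split.
  - intros p. rewrite <- (H2 p). destruct (Lf (h p)) as [(m & e & H) (m' & e' & H')]. split.
    + exists (/ m), (m * e). apply affine_right_inv; auto.
    + exists (/ m'), (m' * e'). apply affine_left_inv; auto.
  - intros t Ht. rewrite <- (Of t Ht) at 1. apply H1.
Qed.

Lemma find_piece_left (b : nat -> R) k x : b 0%nat < x <= b k ->
  exists i, (i < k)%nat /\ b i < x <= b (S i).
Proof.
  induction k as [|k IH]; intros H; [lra|].
  destruct (Rle_dec x (b k)) as [Hx|Hx].
  - destruct IH as (i & Hi & Hb); [lra|]. exists i. split; [lia|assumption].
  - exists k. split; [lia|lra].
Qed.

Lemma PL_plus_homeo f : PL_plus f -> PL_homeo f.
Proof.
  intros (Hout & H0 & H1 & Hinc & k & b & Hb0 & Hbk & Hb & Haff).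
  assert (Hrange : forall x, 0 <= x <= 1 -> 0 <= f x <= 1).
  { intros x Hx. split.
    - destruct (Req_dec x 0) as [->|Hne]; [lra|].
      left. rewrite <- H0. apply Hinc; lra.
    - destruct (Req_dec x 1) as [->|Hne]; [lra|].
      left. rewrite <- H1. apply Hinc; lra. }
  split; [|split; [|split; [|exact Hout]]].
  - intros x y Hxy.
    destruct (Rlt_dec x 0) as [X0|X0]; [rewrite (Hout x) by lra|
      destruct (Rlt_dec 1 x) as [X1|X1]; [rewrite (Hout x) by lra|]];
    (destruct (Rlt_dec y 0) as [Y0|Y0]; [rewrite (Hout y) by lra|
      destruct (Rlt_dec 1 y) as [Y1|Y1]; [rewrite (Hout y) by lra|]]); try lra.
    + pose proof (Hrange y). lra.
    + pose proof (Hrange x). lra.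
    + apply Hinc; lra.
  - intros y. destruct (classic (0 <= y < 1)) as [Hy|Hy].
    + destruct (find_piece (fun i => f (b i)) k y) as (i & Hi & Hyi).
      { rewrite Hb0, Hbk, H0, H1. exact Hy. }
      destruct (Haff i Hi) as (m & c & E). pose proof (Hb i Hi) as Hbi.
      assert (E1 : f (b i) = m * b i + c) by (apply E; lra).
      assert (E2 : f (b (S i)) = m * b (S i) + c) by (apply E; lra).
      assert (Hm : 0 < m) by nra.
      exists (b i + (y - f (b i)) / m).
      assert (0 <= (y - f (b i)) / m) by (apply Rle_mult_inv_pos; lra).
      assert ((y - f (b i)) / m <= b (S i) - b i).
      { apply Rmult_le_reg_r with m; [lra|]. unfold Rdiv.
        rewrite Rmult_assoc, Rinv_l; nra. }
      rewrite E by lra. rewrite E1. field. lra.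
    + destruct (Req_dec y 1) as [->|Hne]; [exists 1; exact H1|].
      exists y. apply Hout. lra.
  - intros p. split.
    + destruct (Rlt_dec p 0) as [P0|P0].
      { exists 1, (- p / 2). split; [lra|]. intros x Hx. rewrite !Hout by lra. ring. }
      destruct (Rlt_dec p 1) as [P1|P1].
      * destruct (find_piece b k p) as (i & Hi & Hp); [lra|].
        destruct (Haff i Hi) as (m & c & E). exists m, (b (S i) - p).
        split; [lra|]. intros x Hx. rewrite !E by lra. ring.
      * assert (Hid : forall x, 1 <= x -> f x = x).
        { intros x [Hx| <-]; [apply Hout; lra|exact H1]. }
        exists 1, 1. split; [lra|]. intros x Hx. rewrite !Hid by lra. ring.
    + destruct (Rlt_dec 1 p) as [P1|P1].
      { exists 1, ((p - 1) / 2). split; [lra|]. intros x Hx. rewrite !Hout by lra. ring. }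
      destruct (Rlt_dec 0 p) as [P0|P0].
      * destruct (find_piece_left b k p) as (i & Hi & Hp); [lra|].
        destruct (Haff i Hi) as (m & c & E). exists m, (p - b i).
        split; [lra|]. intros x Hx. rewrite !E by lra. ring.
      * assert (Hid : forall x, x <= 0 -> f x = x).
        { intros x [Hx| ->]; [apply Hout; lra|exact H0]. }
        exists 1, 1. split; [lra|]. intros x Hx. rewrite !Hid by lra. ring.
Qed.

Lemma gen_list_PL_homeo l : (forall f, In f l -> PL_homeo f) ->
  forall f, gen_list l f -> PL_homeo f.
Proof.
  intros Hl f Hf. induction Hf; auto using PL_homeo_id, PL_homeo_comp.
  eapply PL_homeo_inv; eauto.
Qed.

Lemma PL_homeo_has_inverse f : PL_homeo f ->
  exists h, (forall t, h (f t) = t) /\ (forall t, f (h t) = t).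
Proof.
  intros (If & Sf & _).
  pose (h := fun y => epsilon (inhabits 0) (fun x => f x = y)).
  assert (E : forall y, f (h y) = y) by (intros y; apply epsilon_spec, Sf).
  exists h. split; [|exact E].
  intros t. apply (incr_inj f); [exact If|apply E].
Qed.

Lemma gen_list_incr_group l : (forall f, In f l -> PL_homeo f) -> incr_group (gen_list l).
Proof.
  intros Hl. split; [apply gen_id|]. split; [intros; apply gen_mul; assumption|]. split.
  - intros f Hf.
    destruct (PL_homeo_has_inverse f (gen_list_PL_homeo l Hl f Hf)) as (h & E1 & E2).
    exists h. split; [|auto]. eapply gen_inv; eauto.
  - intros f Hf. apply (gen_list_PL_homeo l Hl f Hf).
Qed.

Lemma gen_list_mono l l' : (forall f, In f l -> gen_list l' f) ->
  forall f, gen_list l f -> gen_list l' f.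
Proof.
  intros H f Hf. induction Hf.
  - apply gen_id.
  - auto.
  - apply gen_mul; assumption.
  - eapply gen_inv; eauto.
Qed.

Lemma iter_in_group G f n : incr_group G -> G f -> G (Nat.iter n f).
Proof.
  intros (Hid & Hmul & _) Hf. induction n as [|n IH]; [exact Hid|].
  exact (Hmul (Nat.iter n f) f IH Hf).
Qed.

(** * Moving finite sets by group elements *)

Lemma iter_moved_strict (v : R -> R) t : strictly_incr v -> t < v t ->
  forall m n, (m < n)%nat -> Nat.iter m v t < Nat.iter n v t.
Proof.
  intros Hv Ht.
  assert (Hs : forall m, Nat.iter m v t < Nat.iter (S m) v t).
  { induction m as [|m IH]; simpl in *; [exact Ht|]. apply Hv, IH. }
  intros m n H. induction H; [apply Hs|]. specialize (Hs m0). lra.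
Qed.

Lemma iter_moved_strict_neg (v : R -> R) t : strictly_incr v -> v t < t ->
  forall m n, (m < n)%nat -> Nat.iter n v t < Nat.iter m v t.
Proof.
  intros Hv Ht.
  assert (Hs : forall m, Nat.iter (S m) v t < Nat.iter m v t).
  { induction m as [|m IH]; simpl in *; [exact Ht|]. apply Hv, IH. }
  intros m n H. induction H; [apply Hs|]. specialize (Hs m0). lra.
Qed.

Lemma iter_moved_inj (v : R -> R) t : strictly_incr v -> v t <> t ->
  forall m n, Nat.iter m v t = Nat.iter n v t -> m = n.
Proof.
  intros Hv Ht m n E.
  destruct (lt_eq_lt_dec m n) as [[H|H]|H]; [|exact H|];
  destruct (Rdichotomy _ _ Ht) as [Hd|Hd].
  - pose proof (iter_moved_strict_neg v t Hv Hd _ _ H). lra.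
  - pose proof (iter_moved_strict v t Hv Hd _ _ H). lra.
  - pose proof (iter_moved_strict_neg v t Hv Hd _ _ H). lra.
  - pose proof (iter_moved_strict v t Hv Hd _ _ H). lra.
Qed.

Lemma eventually_not_unique (P : nat -> Prop) : (forall m n, P m -> P n -> m = n) ->
  exists N, forall n, (N <= n)%nat -> ~ P n.
Proof.
  intros H. destruct (classic (exists m, P m)) as [[m Hm]|Hno].
  - exists (S m). intros n Hn Pn. specialize (H m n Hm Pn). lia.
  - exists 0%nat. intros n _ Pn. apply Hno. eauto.
Qed.

Lemma eventually_list (A : Type) (Q : A -> nat -> Prop) (L : list A) :
  (forall t, In t L -> exists N, forall n, (N <= n)%nat -> Q t n) ->
  exists N, forall n, (N <= n)%nat -> forall t, In t L -> Q t n.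
Proof.
  induction L as [|t L IH]; intros H.
  - exists 0%nat. intros n _ t [].
  - destruct IH as [N HN]; [intros; apply H; right; assumption|].
    destruct (H t) as [N' HN']; [left; reflexivity|].
    exists (max N N'). intros n Hn t' [<-|Ht']; [apply HN'; lia|apply HN; [lia|assumption]].
Qed.

Lemma move_all G (L : list R) : incr_group G ->
  (forall t, In t L -> exists v, G v /\ v t <> t) ->
  exists v, G v /\ forall t, In t L -> v t <> t.
Proof.
  intros HG. pose proof HG as (Hid & Hmul & _ & Hinc).
  induction L as [|t0 L IH]; intros H.
  - exists (fun t => t). split; [exact Hid|]. intros t [].
  - destruct IH as (v & Gv & Hv); [intros; apply H; right; assumption|].
    destruct (Req_dec (v t0) t0) as [Hfix|Hmove].
    + destruct (H t0) as (z & Gz & Hz); [left; reflexivity|].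
      destruct (eventually_list R (fun t n => z (Nat.iter n v t) <> t) L) as [N HN].
      { intros t Ht. apply eventually_not_unique. intros m n Em En.
        apply (iter_moved_inj v t); [exact (Hinc v Gv)|auto|].
        apply (incr_inj z); [exact (Hinc z Gz)|]. congruence. }
      exists (fun t => z (Nat.iter N v t)). split.
      { apply Hmul; [apply iter_in_group; assumption|assumption]. }
      intros t [<-|Ht]; [|apply HN; auto].
      replace (Nat.iter N v t0) with t0; [exact Hz|].
      clear HN. induction N as [|N IHN]; simpl; congruence.
    + exists v. split; [exact Gv|]. intros t [<-|Ht]; auto.
Qed.

Lemma move_off G (L L' : list R) : incr_group G ->
  (forall t, In t L -> exists v, G v /\ v t <> t) ->
  exists w, G w /\ forall t, In t L -> ~ In (w t) L'.
Proof.
  intros HG H. destruct (move_all G L HG H) as (v & Gv & Hv).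
  pose proof HG as (_ & _ & _ & Hinc).
  destruct (eventually_list R (fun t n => forall t', In t' L' -> Nat.iter n v t <> t') L)
    as [N HN].
  { intros t Ht. apply (eventually_list R (fun t' n => Nat.iter n v t <> t')).
    intros t' _. apply eventually_not_unique. intros m n Em En.
    apply (iter_moved_inj v t); [exact (Hinc v Gv)|auto|congruence]. }
  exists (Nat.iter N v). split; [apply iter_in_group; assumption|].
  intros t Ht Hin. exact (HN N (le_n N) t Ht _ Hin eq_refl).
Qed.

(** * Boundary points of the fixed set *)

(** Topological boundary of the fixed set. It contains the left and the right transition points and
    is carried along by conjugation, so disjoint boundaries are a convenient strengthening of
    geometric properness. *)
Definition fix_boundary (f : R -> R) (t : R) : Prop :=
  f t = t /\ forall eps, 0 < eps -> exists s, t - eps < s < t + eps /\ f s <> s.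

Lemma not_supp_fixed f t : 0 <= t <= 1 -> ~ supp f t -> f t = t.
Proof. intros Ht H. apply NNPP. intros E. apply H. split; assumption. Qed.

Lemma left_transition_boundary f t : left_transition f t -> fix_boundary f t.
Proof.
  intros (Ht & Hs & H). split; [apply not_supp_fixed; assumption|].
  intros eps He. destruct (H eps He) as (s & Hst & _ & Hm). exists s. split; [lra|exact Hm].
Qed.

Lemma right_transition_boundary f t : right_transition f t -> fix_boundary f t.
Proof.
  intros (Ht & Hs & H). split; [apply not_supp_fixed; assumption|].
  intros eps He. destruct (H eps He) as (s & Hst & _ & Hm). exists s. split; [lra|exact Hm].
Qed.

Lemma fix_boundary_conj g w wi t : strictly_incr w -> strictly_incr wi ->
  (forall x, wi (w x) = x) -> (forall x, w (wi x) = x) ->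
  fix_boundary (fun x => w (g (wi x))) t -> fix_boundary g (wi t).
Proof.
  intros Iw Iwi E1 E2 [Hfix H]. split.
  - rewrite <- (E1 (g (wi t))), Hfix. reflexivity.
  - intros eps He.
    assert (Hlo : w (wi t - eps) < t) by (rewrite <- (E2 t) at 2; apply Iw; lra).
    assert (Hhi : t < w (wi t + eps)) by (rewrite <- (E2 t) at 1; apply Iw; lra).
    destruct (H (Rmin (t - w (wi t - eps)) (w (wi t + eps) - t))) as (s & Hs & Hm).
    { apply Rmin_glb_lt; lra. }
    pose proof (Rmin_l (t - w (wi t - eps)) (w (wi t + eps) - t)).
    pose proof (Rmin_r (t - w (wi t - eps)) (w (wi t + eps) - t)).
    exists (wi s). split.
    + rewrite <- (E1 (wi t - eps)), <- (E1 (wi t + eps)). split; apply Iwi; lra.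
    + intros E. apply Hm. rewrite E, E2. reflexivity.
Qed.

(** An affine function with two fixed points is the identity, which leaves no boundary point inside
    the interval. *)
Lemma fix_boundary_affine f p q c m : (forall x, p <= x <= q -> f x = c + m * x) ->
  exists z, forall t, p < t < q -> fix_boundary f t -> t = z.
Proof.
  intros E. destruct (classic (exists z, p < z < q /\ fix_boundary f z)) as [(z & Hz & Bz)|Hno].
  - exists z. intros t Ht Bt. destruct (Req_dec t z) as [H|Hne]; [exact H|exfalso].
    destruct Bz as [Fz Bz]. destruct Bt as [Ft _].
    rewrite E in Fz, Ft by lra.
    assert (Hm : m = 1) by nra. subst m.
    destruct (Bz (Rmin (z - p) (q - z))) as (s & Hs & Ms); [apply Rmin_glb_lt; lra|].
    pose proof (Rmin_l (z - p) (q - z)). pose proof (Rmin_r (z - p) (q - z)).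
    apply Ms. rewrite E by lra. lra.
  - exists 0. intros t Ht Bt. exfalso. eauto.
Qed.

(** Compactness of the unit interval through a supremum: at [x], the last point reached, each of the
    two affine germs adds at most one boundary point besides [x], so finiteness extends beyond [x]
    unless 1 has been passed. *)
Lemma fix_boundary_finite f : PL_homeo f ->
  exists L, forall t, fix_boundary f t -> In t L.
Proof.
  intros (If & _ & Lf & Of).
  pose (P := fun x => exists L, forall t, t <= x -> fix_boundary f t -> In t L).
  pose (E := fun x => x <= 1 /\ P x).
  assert (P0 : P 0).
  { exists [0]. intros t [Ht|Ht] [_ Bt]; [exfalso|left; auto].
    destruct (Bt (- t)) as (s & Hs & Ms); [lra|]. apply Ms, Of. lra. }
  destruct (completeness E) as [x [Hub Hlub]].
  { exists 1. intros y [Hy _]. exact Hy. }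
  { exists 0. split; [lra|exact P0]. }
  assert (Hx1 : x <= 1) by (apply Hlub; intros y [Hy _]; exact Hy).
  destruct (Lf x) as [(m & e & He & Hr) (n & d & Hd & Hl)].
  destruct (fix_boundary_affine f (x - d) x (f x - n * x) n) as [z Hz].
  { intros y Hy. rewrite Hl by lra. ring. }
  destruct (fix_boundary_affine f x (x + e) (f x - m * x) m) as [z' Hz'].
  { intros y Hy. rewrite Hr by lra. ring. }
  assert (Hy : exists y, E y /\ x - d < y).
  { apply NNPP. intros Hno. assert (x <= x - d); [|lra].
    apply Hlub. intros y Hy. apply Rnot_lt_le. intros Hlt. apply Hno. eauto. }
  destruct Hy as (y & [_ (L & HL)] & Hyx).
  assert (Hnext : P (x + e / 2)).
  { exists (z :: z' :: x :: L). intros t Ht Bt. simpl.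
    destruct (Rtotal_order t x) as [H|[H|H]]; [|auto|].
    - destruct (Rle_dec t y) as [Hty|Hty]; [auto 6|].
      left. symmetry. apply Hz; [lra|exact Bt].
    - right; left. symmetry. apply Hz'; [lra|exact Bt]. }
  assert (P1 : P 1).
  { destruct (Rle_dec 1 (x + e / 2)) as [H|H].
    - destruct Hnext as [L' HL']. exists L'. intros t Ht. apply HL'. lra.
    - assert (x + e / 2 <= x); [|lra]. apply Hub. split; [lra|exact Hnext]. }
  destruct P1 as [L' HL']. exists L'. intros t Bt.
  destruct (Rle_dec t 1) as [Ht|Ht]; [auto|]. exfalso. destruct Bt as [_ Bt].
  destruct (Bt (t - 1)) as (s & Hs & Ms); [lra|]. apply Ms, Of. lra.
Qed.

Lemma fix_boundary_list f : PL_homeo f ->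
  exists L, forall t, In t L <-> fix_boundary f t.
Proof.
  intros Hf. destruct (fix_boundary_finite f Hf) as [L HL].
  assert (H : exists L', forall t, In t L' <-> In t L /\ fix_boundary f t).
  { clear HL. induction L as [|x L (L' & IH)].
    - exists []. simpl. tauto.
    - destruct (classic (fix_boundary f x)) as [Hx|Hx].
      + exists (x :: L'). intros t. simpl. rewrite IH.
        split; [intros [->|[? ?]]; auto|intros [[->|?] ?]; auto].
      + exists L'. intros t. rewrite IH. simpl.
        split; [intros [? ?]; auto|intros [[->|?] ?]; [contradiction|auto]]. }
  destruct H as [L' H]. exists L'. intros t. rewrite H. split; [tauto|auto].
Qed.

(** The point [u] is the supremum of those up to which [k] is the identity; a right slope equal to 1
    there would allow [u] to be increased. *)
Lemma first_moved k l x0 : strictly_incr k -> locally_PL k ->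
  (forall x, x <= l -> k x = x) -> k x0 <> x0 ->
  exists u rho e, l <= u /\ (forall x, x <= u -> k x = x) /\ 0 < e /\ 0 < rho /\
    rho <> 1 /\ forall x, u <= x <= u + e -> k x = u + rho * (x - u).
Proof.
  intros Ik Lk Hl Hx0.
  pose (E := fun x => forall y, y <= x -> k y = y).
  destruct (completeness E) as [u [Hub Hlub]].
  { exists x0. intros x Hx. apply Rnot_lt_le. intros H. apply Hx0, Hx. lra. }
  { exists l. exact Hl. }
  assert (Hlt : forall y, y < u -> k y = y).
  { intros y Hy. apply NNPP. intros Hne. assert (u <= y); [|lra].
    apply Hlub. intros x Hx. apply Rnot_lt_le. intros H. apply Hne, Hx. lra. }
  destruct (Lk u) as [(rho & e & Hr) (m & d & Hd & Hm)].
  (* The supremum itself is reached through its left germ, which is affine with two fixed points. *)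
  assert (Hu : k u = u).
  { assert (E1 : k (u - d) = u - d) by (apply Hlt; lra).
    assert (E2 : k (u - d / 2) = u - d / 2) by (apply Hlt; lra).
    rewrite Hm in E1, E2 by lra. lra. }
  pose proof (affine_right_pos k u rho e Ik Hr) as Hpos. destruct Hr as [He Hr].
  assert (Hle : forall x, x <= u -> k x = x).
  { intros x [Hx| ->]; auto. }
  rewrite Hu in Hr.
  exists u, rho, e. repeat split; auto.
  intros ->. assert (u + e <= u); [|lra].
  apply Hub. intros y Hy. destruct (Rle_dec y u) as [Hyu|Hyu]; [auto|].
  rewrite Hr by lra. ring.
Qed.

(** Mirror image of [first_moved], applied to the conjugate of [k] by [x -> - x]. *)
Lemma last_moved k r x0 : strictly_incr k -> locally_PL k ->
  (forall x, r <= x -> k x = x) -> k x0 <> x0 ->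
  exists v e, v <= r /\ (forall x, v <= x -> k x = x) /\ 0 < e /\
    forall x, v - e <= x < v -> k x <> x.
Proof.
  intros Ik Lk Hr Hx0.
  destruct (first_moved (fun x => - k (- x)) (- r) (- x0))
    as (u & rho & e & Hu & Hid & He & Hpos & Hne & Haff).
  - intros x y H. apply Ropp_lt_contravar, Ik. lra.
  - intros p. destruct (Lk (- p)) as [(m & e & He & H) (m' & e' & He' & H')]. split.
    + exists m', e'. split; [exact He'|]. intros x Hx. rewrite H' by lra. ring.
    + exists m, e. split; [exact He|]. intros x Hx. rewrite H by lra. ring.
  - intros x Hx. rewrite Hr by lra. ring.
  - rewrite Ropp_involutive. lra.
  - exists (- u), e. split; [lra|]. split; [|split; [exact He|]].
    + intros x Hx. specialize (Hid (- x)). rewrite Ropp_involutive in Hid. lra.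
    + intros x Hx Efix. specialize (Haff (- x)). rewrite Ropp_involutive, Efix in Haff.
      assert (- x = u + rho * (- x - u)) by (apply Haff; lra).
      apply Hne. nra.
Qed.

(** The steps of ratio [q] are too short to jump over the interval, so the first power below [be] is
    still above [al]. *)
Lemma pow_in_interval q al be n : 0 < q < 1 -> 0 < al < be -> be <= 1 -> al < q * be ->
  q ^ n < be -> exists n', al < q ^ n' < be.
Proof.
  intros Hq Hal Hbe Hqb. induction n as [|n IH]; intros Hn; simpl in *; [lra|].
  destruct (Rlt_dec (q ^ n) be) as [H|H]; [auto|].
  exists (S n). simpl. split; [|exact Hn]. nra.
Qed.

(** * Groups with a single interval of support *)

Section SingleOrbital.

Variable G : (R -> R) -> Prop.
Hypothesis HG : incr_group G.
Hypothesis HPL : forall f, G f -> locally_PL f.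
Variables a b : R.
Hypothesis Hab : a < b.
Hypothesis Gfix : forall f, G f -> forall x, x <= a \/ b <= x -> f x = x.
Hypothesis Gmove : forall x, a < x < b -> exists f, G f /\ f x <> x.

Lemma G_mul f g : G f -> G g -> G (fun t => g (f t)).
Proof. destruct HG as (_ & H & _). apply H. Qed.

Lemma G_inv f : G f -> exists h, G h /\ (forall t, h (f t) = t) /\ (forall t, f (h t) = t).
Proof. destruct HG as (_ & _ & H & _). apply H. Qed.

Lemma G_strictly_incr f : G f -> strictly_incr f.
Proof. destruct HG as (_ & _ & _ & H). exact (H f). Qed.

Lemma G_conj g w wi : G g -> G w -> G wi -> G (fun t => w (g (wi t))).
Proof.
  intros Hg Hw Hwi. apply (G_mul (fun t => g (wi t)) w); [|exact Hw].
  apply (G_mul wi g); assumption.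
Qed.

Lemma G_range f x : G f -> a < x < b -> a < f x < b.
Proof.
  intros Hf Hx. pose proof (G_strictly_incr f Hf) as If.
  pose proof (If a x) as H1. pose proof (If x b) as H2.
  rewrite (Gfix f Hf a) in H1 by lra. rewrite (Gfix f Hf b) in H2 by lra.
  split; [apply H1|apply H2]; lra.
Qed.

(** If the infimum of the orbit of [x] were above a, some [f] would move it down; the inverse of [f]
    then moves it up to a larger lower bound. The orbit is negated because [completeness] provides
    suprema. *)
Lemma orbit_down x y : a < x < b -> a < y -> exists g, G g /\ g x < y.
Proof.
  intros Hx Hy.
  pose (E := fun z => exists g, G g /\ z = - g x).
  destruct (completeness E) as [l [Hub Hlub]].
  { exists (- a). intros z (g & Gg & ->). pose proof (G_range g x Gg Hx). lra. }
  { destruct HG as (Hid & _). exists (- x), (fun t => t). auto. }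
  assert (Hlow : forall g, G g -> - l <= g x).
  { intros g Gg. assert (- g x <= l) by (apply Hub; exists g; auto). lra. }
  apply NNPP. intros Hno.
  assert (Hl : l <= - y).
  { apply Hlub. intros z (g & Gg & ->). apply Ropp_le_contravar, Rnot_lt_le.
    intros H. apply Hno. eauto. }
  assert (Hlx : - l <= x).
  { destruct HG as (Hid & _). exact (Hlow _ Hid). }
  assert (Hf : exists f, G f /\ f (- l) < - l).
  { destruct (Gmove (- l)) as (f & Gf & Hf); [lra|].
    destruct (Rdichotomy _ _ Hf) as [H|H]; [eauto|].
    destruct (G_inv f Gf) as (h & Gh & E1 & E2). exists h. split; [exact Gh|].
    rewrite <- (E1 (- l)) at 2. apply G_strictly_incr; assumption. }
  destruct Hf as (f & Gf & Hf). destruct (G_inv f Gf) as (h & Gh & E1 & E2).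
  assert (Hh : - l < h (- l)).
  { rewrite <- (E1 (- l)) at 1. apply G_strictly_incr; assumption. }
  assert (l <= - h (- l)); [|lra].
  apply Hlub. intros z (g & Gg & ->). apply Ropp_le_contravar.
  pose proof (Hlow _ (G_mul g f Gg Gf)) as Hgf. simpl in Hgf.
  apply (incr_le h) in Hgf; [|exact (G_strictly_incr h Gh)]. rewrite E1 in Hgf. exact Hgf.
Qed.

Lemma orbit_up x y : a < x < b -> a < y < b -> exists g, G g /\ y < g x.
Proof.
  intros Hx Hy. destruct (orbit_down y x) as (g & Gg & H); [exact Hy|lra|].
  destruct (G_inv g Gg) as (h & Gh & E1 & E2). exists h. split; [exact Gh|].
  rewrite <- (E1 y). apply G_strictly_incr; assumption.
Qed.

Definition slope_a (f : R -> R) (m : R) : Prop :=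
  exists e, 0 < e /\ forall x, a <= x <= a + e -> f x = a + m * (x - a).

Definition slope_b (f : R -> R) (m : R) : Prop :=
  exists e, 0 < e /\ forall x, b - e <= x <= b -> f x = b - m * (b - x).

Lemma slope_a_affine f m : G f -> slope_a f m <-> exists e, affine_right f a m e.
Proof.
  intros Gf. unfold slope_a, affine_right. rewrite (Gfix f Gf a) by lra. reflexivity.
Qed.

Lemma slope_b_affine f m : G f -> slope_b f m <-> exists e, affine_left f b m e.
Proof.
  intros Gf. unfold slope_b, affine_left. rewrite (Gfix f Gf b) by lra.
  split; intros (e & He & H); exists e; (split; [exact He|]);
    intros x Hx; rewrite H by exact Hx; ring.
Qed.

Lemma slope_a_ex f : G f -> exists m, slope_a f m.
Proof.
  intros Gf. destruct (HPL f Gf a) as [(m & e & H) _]. exists m.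
  apply slope_a_affine; eauto.
Qed.

Lemma slope_b_ex f : G f -> exists m, slope_b f m.
Proof.
  intros Gf. destruct (HPL f Gf b) as [_ (m & e & H)]. exists m.
  apply slope_b_affine; eauto.
Qed.

Lemma slope_a_pos f m : G f -> slope_a f m -> 0 < m.
Proof.
  intros Gf H. apply slope_a_affine in H as [e H]; [|exact Gf].
  eapply affine_right_pos; [apply G_strictly_incr; exact Gf|exact H].
Qed.

Lemma slope_b_pos f m : G f -> slope_b f m -> 0 < m.
Proof.
  intros Gf H. apply slope_b_affine in H as [e H]; [|exact Gf].
  eapply affine_left_pos; [apply G_strictly_incr; exact Gf|exact H].
Qed.

Lemma slope_a_unique f m n : slope_a f m -> slope_a f n -> m = n.
Proof.
  intros (e & He & H) (d & Hd & K).
  pose proof (Rmin_l e d). pose proof (Rmin_r e d). pose proof (Rmin_glb_lt e d 0 He Hd).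
  assert (E : a + m * (a + Rmin e d - a) = a + n * (a + Rmin e d - a))
    by (rewrite <- H, <- K by lra; reflexivity).
  nra.
Qed.

Lemma slope_a_comp f g m n : G f -> G g -> slope_a f m -> slope_a g n ->
  slope_a (fun t => g (f t)) (n * m).
Proof.
  intros Gf Gg Hf Hg. apply slope_a_affine; [apply G_mul; assumption|].
  apply slope_a_affine in Hf as [e He]; [|exact Gf].
  apply slope_a_affine in Hg as [d Hd]; [|exact Gg].
  apply (affine_right_comp f g a m e n d); [apply G_strictly_incr; exact Gf|exact He|].
  rewrite (Gfix f Gf a) by lra. exact Hd.
Qed.

Lemma slope_b_comp f g m n : G f -> G g -> slope_b f m -> slope_b g n ->
  slope_b (fun t => g (f t)) (n * m).
Proof.
  intros Gf Gg Hf Hg. apply slope_b_affine; [apply G_mul; assumption|].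
  apply slope_b_affine in Hf as [e He]; [|exact Gf].
  apply slope_b_affine in Hg as [d Hd]; [|exact Gg].
  apply (affine_left_comp f g b m e n d); [apply G_strictly_incr; exact Gf|exact He|].
  rewrite (Gfix f Gf b) by lra. exact Hd.
Qed.

Lemma slope_a_inv f h m : G f -> G h -> (forall t, h (f t) = t) -> slope_a f m ->
  slope_a h (/ m).
Proof.
  intros Gf Gh E H. apply slope_a_affine; [exact Gh|].
  apply slope_a_affine in H as [e He]; [|exact Gf].
  exists (m * e). rewrite <- (Gfix f Gf a) by lra.
  apply affine_right_inv; [apply G_strictly_incr; exact Gf|exact E|exact He].
Qed.

Lemma slope_b_inv f h m : G f -> G h -> (forall t, h (f t) = t) -> slope_b f m ->
  slope_b h (/ m).
Proof.
  intros Gf Gh E H. apply slope_b_affine; [exact Gh|].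
  apply slope_b_affine in H as [e He]; [|exact Gf].
  exists (m * e). rewrite <- (Gfix f Gf b) by lra.
  apply affine_left_inv; [apply G_strictly_incr; exact Gf|exact E|exact He].
Qed.

Lemma slope_b_conj g w wi m : G g -> G w -> G wi -> (forall t, wi (w t) = t) ->
  (forall t, w (wi t) = t) -> slope_b g m -> slope_b (fun t => w (g (wi t))) m.
Proof.
  intros Gg Gw Gwi E1 E2 Hg. destruct (slope_b_ex w Gw) as [n Hn].
  pose proof (slope_b_pos w n Gw Hn) as Hnpos.
  replace m with (n * (m * / n)) by (field; lra).
  apply (slope_b_comp (fun t => g (wi t)) w).
  - apply (G_mul wi g); assumption.
  - exact Gw.
  - apply (slope_b_comp wi g); auto. apply (slope_b_inv w wi); auto.
  - exact Hn.
Qed.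

Lemma slope_a_one_trivial f : G f -> slope_a f 1 ->
  exists l, a < l < b /\ forall x, x <= l -> f x = x.
Proof.
  intros Gf (e & He & H). exists (Rmin (a + e) ((a + b) / 2)).
  pose proof (Rmin_l (a + e) ((a + b) / 2)). pose proof (Rmin_r (a + e) ((a + b) / 2)).
  split; [split; [apply Rmin_glb_lt; lra|lra]|].
  intros x Hx. destruct (Rle_dec x a) as [Hxa|Hxa]; [apply Gfix; auto|].
  rewrite H by lra. ring.
Qed.

Lemma slope_b_one_trivial f : G f -> slope_b f 1 ->
  exists r, a < r < b /\ forall x, r <= x -> f x = x.
Proof.
  intros Gf (e & He & H). exists (Rmax (b - e) ((a + b) / 2)).
  pose proof (Rmax_l (b - e) ((a + b) / 2)). pose proof (Rmax_r (b - e) ((a + b) / 2)).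
  split; [split; [lra|apply Rmax_lub_lt; lra]|].
  intros x Hx. destruct (Rle_dec b x) as [Hxb|Hxb]; [apply Gfix; auto|].
  rewrite H by lra. ring.
Qed.

Lemma iter_contract_b h mu e n x : 0 < mu < 1 ->
  (forall x, b - e <= x <= b -> h x = b - mu * (b - x)) -> b - e <= x <= b ->
  Nat.iter n h x = b - mu ^ n * (b - x).
Proof.
  intros Hmu H Hx. induction n as [|n IH]; simpl; [ring|].
  assert (0 < mu ^ n <= 1).
  { split; [apply pow_lt; lra|]. rewrite <- (pow1 n). apply pow_incr. lra. }
  rewrite IH, H by nra. ring.
Qed.

Lemma iter_contract_a h mu e n x : 0 < mu < 1 ->
  (forall x, a <= x <= a + e -> h x = a + mu * (x - a)) -> a <= x <= a + e ->
  Nat.iter n h x = a + mu ^ n * (x - a).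
Proof.
  intros Hmu H Hx. induction n as [|n IH]; simpl; [ring|].
  assert (0 < mu ^ n <= 1).
  { split; [apply pow_lt; lra|]. rewrite <- (pow1 n). apply pow_incr. lra. }
  rewrite IH, H by nra. ring.
Qed.

Lemma pow_small mu eps : 0 < mu < 1 -> 0 < eps -> exists n, mu ^ n < eps.
Proof.
  intros Hmu He. destruct (pow_lt_1_zero mu) with (y := eps) as [N HN].
  - rewrite Rabs_right; lra.
  - exact He.
  - exists N. specialize (HN N (le_n N)).
    rewrite Rabs_right in HN; [exact HN|]. left. apply pow_lt. lra.
Qed.

(* A conjugate of h agrees with h near b but already contracts towards b from below
   the support of h; large powers of the two satisfy the hypotheses of
   [contains_F_of_pair]. *)
Lemma contains_F_one_sided_contracting h mu : G h -> slope_a h 1 -> slope_b h mu ->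
  mu < 1 -> contains_F G.
Proof.
  intros Gh Ha Hb Hmu1. pose proof (slope_b_pos h mu Gh Hb) as Hmu0.
  destruct (slope_a_one_trivial h Gh Ha) as (s & Hs & Hid).
  destruct Hb as (e0 & He0 & H0).
  (* The cap keeps [b - e] inside (a, b), where orbits are available. *)
  set (e := Rmin e0 ((b - a) / 2)).
  assert (He : 0 < e < b - a).
  { pose proof (Rmin_r e0 ((b - a) / 2)). unfold e. split; [apply Rmin_glb_lt; lra|lra]. }
  assert (H : forall x, b - e <= x <= b -> h x = b - mu * (b - x)).
  { intros x Hx. pose proof (Rmin_l e0 ((b - a) / 2)) as Hm. apply H0. fold e in Hm. lra. }
  clearbody e. clear e0 He0 H0.
  destruct (orbit_down (b - e) s) as (g & Gg & Hg); [lra|lra|].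
  destruct (G_inv g Gg) as (gi & Ggi & E1 & E2).
  assert (Hsb : b - e < gi s < b).
  { split.
    - rewrite <- (E1 (b - e)). apply G_strictly_incr; assumption.
    - apply G_range; [exact Ggi|lra]. }
  set (h' := fun t => g (h (gi t))).
  assert (Gh' : G h') by (apply G_conj; assumption).
  assert (Hagree : exists t, b - e <= t < b /\ s < t /\ forall x, t <= x -> h' x = h x).
  { assert (Hb' : slope_b h' mu).
    { apply slope_b_conj; auto. exists e. split; [lra|exact H]. }
    destruct Hb' as (d & Hd & H').
    set (t := Rmax (Rmax (b - e) (b - d)) ((s + b) / 2)).
    pose proof (Rmax_l (Rmax (b - e) (b - d)) ((s + b) / 2)).
    pose proof (Rmax_r (Rmax (b - e) (b - d)) ((s + b) / 2)).
    pose proof (Rmax_l (b - e) (b - d)). pose proof (Rmax_r (b - e) (b - d)).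
    exists t. unfold t. split; [split; [lra|repeat apply Rmax_lub_lt; lra]|].
    split; [lra|].
    intros x Hx. destruct (Rle_dec b x) as [Hxb|Hxb].
    - rewrite !Gfix; auto.
    - rewrite H', H by lra. reflexivity. }
  destruct Hagree as (t & Ht & Hst & Hagree).
  assert (Hup : forall x, t <= x -> t <= h x).
  { intros x Hx. destruct (Rle_dec b x) as [Hxb|Hxb]; [rewrite Gfix; auto|].
    rewrite H by lra. nra. }
  assert (Hiter : forall n x, t <= x ->
    Nat.iter n h' x = Nat.iter n h x /\ t <= Nat.iter n h x).
  { intros n x Hx. induction n as [|n [IH1 IH2]]; simpl; [auto|].
    rewrite IH1, Hagree by assumption. auto. }
  assert (Hgit : gi t < b) by (apply G_range; [exact Ggi|lra]).
  (* With this [n], [h ^ n] carries [gi s] to [gi t] or beyond; conjugated by [g], [h' ^ n] carries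
     [s] to [t] or beyond. *)
  destruct (pow_small mu ((b - gi t) / (b - gi s))) as [n Hn].
  { lra. }
  { apply Rdiv_lt_0_compat; lra. }
  apply (contains_F_of_pair G (Nat.iter n h') (Nat.iter n h) s t); auto.
  - apply iter_in_group; assumption.
  - apply iter_in_group; assumption.
  - intros x Hx. clear Hn. induction n as [|n IH]; simpl; [reflexivity|]. rewrite IH. auto.
  - intros x Hx. apply Hiter. exact Hx.
  - assert (Hconj : forall k, Nat.iter k h' s = g (Nat.iter k h (gi s))).
    { induction k as [|k IHk]; simpl; [rewrite E2; reflexivity|].
      rewrite IHk. unfold h'. rewrite E1. reflexivity. }
    rewrite Hconj, <- (E2 t). apply incr_le; [exact (G_strictly_incr g Gg)|].
    rewrite (iter_contract_b h mu e) by (auto; lra).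
    assert (mu ^ n * (b - gi s) <= b - gi t); [|lra].
    apply Rmult_le_reg_r with (/ (b - gi s)); [apply Rinv_0_lt_compat; lra|].
    rewrite Rmult_assoc, Rinv_r by lra. unfold Rdiv in Hn. lra.
Qed.

Lemma contains_F_one_sided h mu : G h -> slope_a h 1 -> slope_b h mu -> mu <> 1 ->
  contains_F G.
Proof.
  intros Gh Ha Hb Hne. destruct (Rdichotomy _ _ Hne) as [H|H].
  - exact (contains_F_one_sided_contracting h mu Gh Ha Hb H).
  - destruct (G_inv h Gh) as (k & Gk & E1 & E2).
    apply (contains_F_one_sided_contracting k (/ mu) Gk).
    + rewrite <- Rinv_1. apply (slope_a_inv h k); assumption.
    + apply (slope_b_inv h k); assumption.
    + rewrite <- Rinv_1. apply Rinv_lt_contravar; lra.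
Qed.

(** As long as the iterates stay below [t] they remain in the zone of the homothety, where the
    distance to [u] grows geometrically. *)
Lemma iter_escape k u rho e y t : 1 < rho ->
  (forall x, u <= x <= u + e -> k x = u + rho * (x - u)) -> t <= u + e -> u < y ->
  exists n, t <= Nat.iter n k y.
Proof.
  intros Hrho H Ht Hy. apply NNPP. intros Hno.
  assert (Hlt : forall n, Nat.iter n k y < t).
  { intros n. apply Rnot_le_lt. intros Hn. apply Hno. eauto. }
  assert (Hit : forall n, Nat.iter n k y = u + rho ^ n * (y - u)).
  { induction n as [|n IH]; simpl; [ring|].
    pose proof (Hlt n) as Hn. rewrite IH in *.
    assert (0 < rho ^ n) by (apply pow_lt; lra).
    rewrite H by nra. ring. }
  destruct (Pow_x_infinity rho) with (b := (t - u) / (y - u)) as [N HN].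
  { rewrite Rabs_right; lra. }
  specialize (HN N (le_n N)). rewrite Rabs_right in HN.
  2:{ apply Rle_ge. left. apply pow_lt. lra. }
  specialize (Hlt N). rewrite Hit in Hlt.
  assert ((t - u) / (y - u) * (y - u) = t - u) by (field; lra).
  nra.
Qed.

(** Either [p] or its inverse pushes [u] to the right, and [k] expands from [u], so some [k ^ n]
    brings that image up to [t]. The two elements are then [k ^ n] applied after [p] or its inverse,
    and [k ^ n] alone: they agree from [t] on, where [p] is trivial. *)
Lemma contains_F_overlap k p u rho e t : G k -> G p -> u < t <= u + e -> 1 < rho ->
  (forall x, x <= u -> k x = x) ->
  (forall x, u <= x <= u + e -> k x = u + rho * (x - u)) ->
  (forall x, t <= x -> p x = x) -> p u <> u -> contains_F G.
Proof.
  intros Gk Gp Ht Hrho Hid Hk Hpid Hpu.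
  assert (Hp : exists q, G q /\ (forall x, t <= x -> q x = x) /\ u < q u).
  { destruct (Rdichotomy _ _ Hpu) as [H|H].
    - destruct (G_inv p Gp) as (q & Gq & E1 & E2). exists q. split; [exact Gq|]. split.
      + intros x Hx. rewrite <- (Hpid x Hx) at 1. apply E1.
      + rewrite <- (E1 u) at 1. apply G_strictly_incr; assumption.
    - exists p. auto. }
  destruct Hp as (q & Gq & Hqid & Hqu).
  destruct (iter_escape k u rho e (q u) t) as [n Hn]; auto; try lra.
  apply (contains_F_of_pair G (fun x => Nat.iter n k (q x)) (Nat.iter n k) u t); auto.
  - apply (G_mul q (Nat.iter n k)); [exact Gq|apply iter_in_group; assumption].
  - apply iter_in_group; assumption.
  - lra.
  - intros x Hx. clear Hn. induction n as [|n IH]; simpl; [reflexivity|]. rewrite IH. auto.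
  - intros x Hx. rewrite Hqid by exact Hx. reflexivity.
Qed.

(** * Nondiscrete slopes at the left endpoint *)

Definition nondiscrete_slopes : Prop :=
  forall eps, 0 < eps -> exists g m, G g /\ slope_a g m /\ 1 < m < 1 + eps.

Lemma slope_a_iter g m n : G g -> slope_a g m -> slope_a (Nat.iter n g) (m ^ n).
Proof.
  intros Gg Hg. induction n as [|n IH]; simpl.
  - exists 1. split; [lra|]. intros x Hx. simpl. ring.
  - apply (slope_a_comp (Nat.iter n g) g); auto. apply iter_in_group; assumption.
Qed.

(** A slope [m] between 1 and [be / al] is taken; the powers of [/ m] descend in steps too small to
    miss the window. *)
Lemma slopes_dense al be : nondiscrete_slopes -> 0 < al < be -> be <= 1 ->
  exists g m, G g /\ slope_a g m /\ al < m < be.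
Proof.
  intros HN Hal Hbe.
  assert (Hr : be / al * al = be) by (field; lra).
  destruct (HN (be / al - 1)) as (g & m & Gg & Hg & Hm); [nra|].
  destruct (G_inv g Gg) as (h & Gh & E1 & E2).
  assert (Hmi : m * / m = 1) by (field; lra).
  assert (Hq : 0 < / m < 1) by (split; [apply Rinv_0_lt_compat; lra|nra]).
  assert (Hqb : al < / m * be).
  { apply Rmult_lt_reg_l with m; [lra|]. rewrite <- Rmult_assoc, Hmi. nra. }
  destruct (pow_small (/ m) be) as [n Hn]; [exact Hq|lra|].
  destruct (pow_in_interval (/ m) al be n) as [n' Hn']; auto.
  exists (Nat.iter n' h), ((/ m) ^ n'). split; [apply iter_in_group; assumption|].
  split; [|exact Hn']. apply slope_a_iter; [exact Gh|]. apply (slope_a_inv g h); assumption.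
Qed.

Lemma contraction_at_a : nondiscrete_slopes ->
  exists f mu e, G f /\ 0 < mu < 1 /\ 0 < e /\
    forall x, a <= x <= a + e -> f x = a + mu * (x - a).
Proof.
  intros HN. destruct (slopes_dense (1 / 2) 1) as (f & mu & Gf & (e & He & H) & Hmu);
    [exact HN|lra|lra|].
  exists f, mu, e. repeat split; auto; lra.
Qed.

(* Conjugating by powers of a contraction f at a widens the interval on which g is a
   homothety of centre a to all of the interval on which f is one. *)
Lemma conj_homothety f mu e g m : G f -> 0 < mu < 1 -> 0 < e ->
  (forall x, a <= x <= a + e -> f x = a + mu * (x - a)) ->
  G g -> slope_a g m -> m <= 1 ->
  exists g', G g' /\ forall x, a <= x <= a + e -> g' x = a + m * (x - a).
Proof.
  intros Gf Hmu He Hf Gg Hg Hm1. pose proof (slope_a_pos g m Gg Hg) as Hm0.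
  destruct Hg as (d & Hd & Hg).
  destruct (pow_small mu (d / e)) as [n Hn]; [exact Hmu|apply Rdiv_lt_0_compat; lra|].
  pose proof (iter_in_group G f n HG Gf) as GF.
  destruct (G_inv _ GF) as (Fi & GFi & E1 & E2).
  exists (fun x => Fi (g (Nat.iter n f x))). split; [apply G_conj; assumption|].
  intros x Hx. rewrite <- (E1 (a + m * (x - a))). f_equal.
  assert (Hpos : 0 < mu ^ n) by (apply pow_lt; lra).
  assert (Hde : d / e * e = d) by (field; lra).
  assert (mu ^ n * (x - a) <= d) by nra.
  rewrite !(iter_contract_a f mu e) by (auto; nra).
  rewrite Hg by nra. ring.
Qed.

(** Conjugation by an element sending the right end of the support below [c] moves the whole support
    there, and passing to the inverse if necessary makes the slope at the left end exceed 1. *)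
Lemma exists_compactly_supported_expanding k x0 c : nondiscrete_slopes ->
  G k -> slope_a k 1 -> slope_b k 1 -> k x0 <> x0 -> a < c ->
  exists k' x1 u r rho e, G k' /\ k' x1 <> x1 /\ a < u /\ r < c /\ 0 < e /\ 1 < rho /\
    (forall x, x <= u -> k' x = x) /\ (forall x, r <= x -> k' x = x) /\
    (forall x, u <= x <= u + e -> k' x = u + rho * (x - u)).
Proof.
  intros HN Gk Ha Hb Hx0 Hc.
  destruct (slope_a_one_trivial k Gk Ha) as (l & Hl & Hidl).
  destruct (slope_b_one_trivial k Gk Hb) as (r & Hr & Hidr).
  destruct (orbit_down r c) as (w & Gw & Hw); [exact Hr|exact Hc|].
  destruct (G_inv w Gw) as (wi & Gwi & E1 & E2).
  pose proof (G_strictly_incr w Gw) as Iw. pose proof (G_strictly_incr wi Gwi) as Iwi.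
  pose (k1 := fun t => w (k (wi t))).
  assert (Gk1 : G k1) by (apply G_conj; assumption).
  assert (H1l : forall x, x <= w l -> k1 x = x).
  { intros x Hx. unfold k1. rewrite Hidl; [apply E2|].
    rewrite <- (E1 l). apply incr_le; assumption. }
  assert (H1r : forall x, w r <= x -> k1 x = x).
  { intros x Hx. unfold k1. rewrite Hidr; [apply E2|].
    rewrite <- (E1 r). apply incr_le; assumption. }
  assert (H1x : k1 (w x0) <> w x0).
  { unfold k1. rewrite E1. intros E. apply Hx0. apply (incr_inj w); assumption. }
  assert (Hwl : a < w l) by (apply G_range; [exact Gw|lra]).
  destruct (first_moved k1 (w l) (w x0)) as (u & rho & e & Hu & Hid & He & Hp & Hne & Haff);
    auto; [apply G_strictly_incr; exact Gk1|].
  destruct (Rdichotomy _ _ Hne) as [Hlt|Hgt].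
  - destruct (G_inv k1 Gk1) as (k2 & Gk2 & F1 & F2).
    exists k2, (w x0), u, (w r), (/ rho), (rho * e).
    repeat split; auto; try lra.
    + intros E. apply H1x. rewrite <- E at 1. apply F2.
    + nra.
    + rewrite <- Rinv_1. apply Rinv_lt_contravar; lra.
    + intros x Hx. rewrite <- (Hid x Hx) at 1. apply F1.
    + intros x Hx. rewrite <- (H1r x Hx) at 1. apply F1.
    + assert (Hku : k1 u = u) by (apply Hid; lra).
      destruct (affine_right_inv k1 k2 u rho e) as [_ Hinv].
      * apply G_strictly_incr; exact Gk1.
      * exact F1.
      * split; [exact He|]. rewrite Hku. exact Haff.
      * rewrite Hku in Hinv. intros x Hx. rewrite Hinv by exact Hx.
        rewrite <- Hku at 1. rewrite F1. reflexivity.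
  - exists k1, (w x0), u, (w r), rho, e. repeat split; auto; lra.
Qed.

(** Let u and v be the ends of the support of [k']. A homothety [g'] with ratio just above
    [(u - a) / (v - a)] puts v slightly to the right of u, so the conjugate of [k'] by [g'] is
    trivial soon after u, yet moves u: the preimage of u under [g'] lies just below v, where [k']
    fixes no point. *)
Lemma contains_F_nondiscrete_kernel k x0 : nondiscrete_slopes ->
  G k -> slope_a k 1 -> slope_b k 1 -> k x0 <> x0 -> contains_F G.
Proof.
  intros HN Gk Ha Hb Hx0.
  destruct (contraction_at_a HN) as (f & mu & ef & Gf & Hmu & Hef & Hf).
  destruct (exists_compactly_supported_expanding k x0 (a + ef))
    as (k' & x1 & u & r & rho & e & Gk' & Hx1 & Hau & Hr & He & Hrho & Hidu & Hidr & Haff);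
    auto; [lra|].
  clear k Gk Ha Hb x0 Hx0.
  destruct (last_moved k' r x1) as (v & d0 & Hvr & Hidv & Hd0 & Hmv); auto.
  { apply G_strictly_incr; exact Gk'. }
  assert (Huv : u < v).
  { apply Rnot_le_lt. intros H. destruct (Rle_dec x1 u) as [Hx|Hx]; [auto|].
    apply Hx1, Hidv. lra. }
  set (A := u - a). set (B := v - a).
  assert (HA : 0 < A) by (unfold A; lra). assert (HB : A < B) by (unfold A, B; lra).
  (* The cap keeps [B - d] positive, so that [A / (B - d)] is a legitimate bound on the ratio. *)
  set (d := Rmin d0 (B / 2)).
  assert (Hd : 0 < d <= d0 /\ d <= B / 2).
  { unfold d. pose proof (Rmin_l d0 (B / 2)). pose proof (Rmin_r d0 (B / 2)).
    split; [split; [apply Rmin_glb_lt; lra|lra]|lra]. }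
  (* the homothety of ratio m < be must carry v just above u, and v - d below u *)
  set (be := Rmin 1 (Rmin ((A + e) / B) (A / (B - d)))).
  assert (E1 : (A + e) / B * B = A + e) by (field; lra).
  assert (E2 : A / (B - d) * (B - d) = A) by (field; lra).
  assert (E3 : A / B * B = A) by (field; lra).
  assert (Hpos : 0 < A / B) by (apply Rdiv_lt_0_compat; lra).
  assert (Hpos2 : 0 < A / (B - d)) by (apply Rdiv_lt_0_compat; lra).
  destruct (slopes_dense (A / B) be) as (g & m & Gg & Hg & Hm); auto.
  { split; [exact Hpos|]. unfold be. repeat apply Rmin_glb_lt; nra. }
  { unfold be. apply Rmin_l. }
  assert (Hbe : be <= 1 /\ be <= (A + e) / B /\ be <= A / (B - d)).
  { unfold be. pose proof (Rmin_l 1 (Rmin ((A + e) / B) (A / (B - d)))).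
    pose proof (Rmin_r 1 (Rmin ((A + e) / B) (A / (B - d)))).
    pose proof (Rmin_l ((A + e) / B) (A / (B - d))).
    pose proof (Rmin_r ((A + e) / B) (A / (B - d))). lra. }
  assert (Hm0 : 0 < m) by lra.
  assert (HmB : A < m * B < A + e) by nra.
  assert (Hmd : m * (B - d) < A) by nra.
  destruct (conj_homothety f mu ef g m) as (g' & Gg' & Hg'); auto; [lra|].
  destruct (G_inv g' Gg') as (gi & Ggi & F1 & F2).
  assert (Hgv : g' v = a + m * B) by (apply Hg'; unfold B in *; lra).
  apply (contains_F_overlap k' (fun t => g' (k' (gi t))) u rho e (a + m * B)); auto.
  - apply G_conj; assumption.
  - unfold A in *. lra.
  - intros x Hx. rewrite <- Hgv in Hx.
    rewrite Hidv; [apply F2|].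
    rewrite <- (F1 v). apply incr_le; [exact (G_strictly_incr gi Ggi)|exact Hx].
  - assert (EA : A / m * m = A) by (field; lra).
    assert (HAm : B - d < A / m < B) by (split; nra).
    assert (Hu : g' (a + A / m) = u).
    { rewrite Hg'.
      - replace (a + m * (a + A / m - a)) with (a + A / m * m) by ring.
        rewrite EA. unfold A. ring.
      - unfold B in *. lra. }
    rewrite <- Hu at 1. rewrite F1. intros E.
    apply (Hmv (a + A / m)); [unfold B in *; lra|].
    apply (incr_inj g'); [exact (G_strictly_incr g' Gg')|]. rewrite Hu. exact E.
Qed.

(** A commutator has slope 1 at a, since slopes multiply, and is therefore trivial. *)
Lemma trivial_kernel_commute f g x :
  (forall k, G k -> slope_a k 1 -> forall x, k x = x) -> G f -> G g -> f (g x) = g (f x).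
Proof.
  intros Hker Gf Gg. destruct (G_inv f Gf) as (fi & Gfi & E1 & E2).
  destruct (G_inv g Gg) as (gi & Ggi & F1 & F2).
  destruct (slope_a_ex f Gf) as [m Hm]. destruct (slope_a_ex g Gg) as [n Hn].
  pose proof (slope_a_pos f m Gf Hm). pose proof (slope_a_pos g n Gg Hn).
  assert (Ggf : G (fun x => g (f x))) by (apply G_mul; assumption).
  assert (Gii : G (fun x => gi (fi x))) by (apply G_mul; assumption).
  assert (K : gi (fi (g (f x))) = x).
  { apply (Hker (fun x => gi (fi (g (f x))))).
    - apply (G_mul (fun x => g (f x)) (fun x => gi (fi x))); assumption.
    - replace 1 with ((/ n * / m) * (n * m)) by (field; lra).
      apply (slope_a_comp (fun x => g (f x)) (fun x => gi (fi x))); auto.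
      + apply slope_a_comp; assumption.
      + apply (slope_a_comp fi gi); auto; [apply (slope_a_inv f fi)|apply (slope_a_inv g gi)];
          assumption. }
  rewrite <- K at 1. rewrite F2, E2. reflexivity.
Qed.

(* Here G is abelian, so each g in G is a homothety on fixed neighbourhoods of a and b.
   If f carries a small interval near a affinely into the one at b, then fg = gf would
   equate the displacement of g seen from a, which increases along the interval, with
   its displacement seen from b, which decreases. *)
Lemma nondiscrete_kernel_nontrivial : nondiscrete_slopes ->
  ~ (forall k, G k -> slope_a k 1 -> forall x, k x = x).
Proof.
  intros HN Hker.
  assert (Hcomm : forall f g x, G f -> G g -> f (g x) = g (f x))
    by (intros; apply trivial_kernel_commute; assumption).
  destruct (contraction_at_a HN) as (f0 & mu & e0 & Gf0 & Hmu & He0 & Hf0).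
  assert (Hf1 : exists f1 nu e1, G f1 /\ 0 < nu < 1 /\ 0 < e1 /\
    forall x, b - e1 <= x <= b -> f1 x = b - nu * (b - x)).
  { destruct (slope_b_ex f0 Gf0) as [nu Hnu]. pose proof (slope_b_pos f0 nu Gf0 Hnu).
    destruct (Rtotal_order nu 1) as [Hlt|[->|Hgt]].
    - destruct Hnu as (e1 & He1 & H1). exists f0, nu, e1. auto.
    (* Trivial near b, [f0] would fix some c, and by commutation the whole orbit of c; but that
       orbit enters the zone where [f0] is a contraction with a as its only fixed point. *)
    - exfalso. destruct (slope_b_one_trivial f0 Gf0 Hnu) as (c & Hc & Hid).
      destruct (orbit_down c (a + e0)) as (g & Gg & Hg); [exact Hc|lra|].
      pose proof (G_range g c Gg Hc) as Hgc.
      assert (E : f0 (g c) = g c) by (rewrite Hcomm, Hid by (auto; lra); reflexivity).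
      rewrite Hf0 in E by lra. nra.
    - destruct (G_inv f0 Gf0) as (fi & Gfi & E1 & E2).
      assert (Hi : slope_b fi (/ nu)) by (apply (slope_b_inv f0 fi); assumption).
      destruct Hi as (e1 & He1 & H1). exists fi, (/ nu), e1. repeat split; auto.
      + apply Rinv_0_lt_compat; lra.
      + rewrite <- Rinv_1. apply Rinv_lt_contravar; lra. }
  destruct Hf1 as (f1 & nu & e1 & Gf1 & Hnu & He1 & Hf1).
  set (x0 := a + Rmin (e0 / 2) ((b - a) / 2)).
  assert (Hx0 : a < x0 < b /\ x0 <= a + e0 / 2).
  { unfold x0. pose proof (Rmin_l (e0 / 2) ((b - a) / 2)).
    pose proof (Rmin_r (e0 / 2) ((b - a) / 2)).
    assert (0 < Rmin (e0 / 2) ((b - a) / 2)) by (apply Rmin_glb_lt; lra). lra. }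
  set (y0 := Rmax (b - e1) ((a + b) / 2)).
  assert (Hy0 : a < y0 < b /\ b - e1 <= y0).
  { unfold y0. pose proof (Rmax_l (b - e1) ((a + b) / 2)).
    pose proof (Rmax_r (b - e1) ((a + b) / 2)).
    split; [split; [lra|apply Rmax_lub_lt; lra]|lra]. }
  destruct (orbit_up x0 y0) as (f & Gf & Hfx); [lra|lra|].
  pose proof (G_strictly_incr f Gf) as If.
  destruct (HPL f Gf x0) as [(sl & d0 & Hsl) _].
  pose proof (affine_right_pos f x0 sl d0 If Hsl) as Hslp. destruct Hsl as [Hd0 Hsl].
  set (d := Rmin d0 (Rmin (e0 / 2) ((b - x0) / 2))).
  assert (Hd : 0 < d <= d0 /\ d <= e0 / 2 /\ d < b - x0).
  { unfold d. pose proof (Rmin_l d0 (Rmin (e0 / 2) ((b - x0) / 2))).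
    pose proof (Rmin_r d0 (Rmin (e0 / 2) ((b - x0) / 2))).
    pose proof (Rmin_l (e0 / 2) ((b - x0) / 2)). pose proof (Rmin_r (e0 / 2) ((b - x0) / 2)).
    assert (0 < Rmin d0 (Rmin (e0 / 2) ((b - x0) / 2))) by (repeat apply Rmin_glb_lt; lra).
    lra. }
  clearbody x0 y0 d.
  (* On the zone of width [e0] such a [g] displaces points by less than [d / 2], so it maps the
     first half of [[x0, x0 + d]] into that interval, on which [f] is affine. *)
  destruct (HN (d / 2 / e0)) as (g & m & Gg & Hg & Hm); [repeat apply Rdiv_lt_0_compat; lra|].
  assert (Hme : (m - 1) * e0 < d / 2).
  { assert (d / 2 / e0 * e0 = d / 2) by (field; lra). nra. }
  destruct (slope_b_ex g Gg) as [m' Hm'].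
  (* A power of [f0] contracts x into the small neighbourhood of a where the formula is known, and
     commutation carries it back. The same argument with [f1] works at b. *)
  assert (Hga : forall x, a <= x -> x <= x0 + d / 2 -> g x = a + m * (x - a)).
  { intros x Hxa Hx. destruct Hg as (eg & Heg & Hg).
    destruct (pow_small mu (eg / e0)) as [n Hn]; [exact Hmu|apply Rdiv_lt_0_compat; lra|].
    pose proof (iter_in_group G f0 n HG Gf0) as GF.
    assert (Hpos : 0 < mu ^ n) by (apply pow_lt; lra).
    assert (Hde : eg / e0 * e0 = eg) by (field; lra).
    assert (mu ^ n * (x - a) <= eg) by nra.
    apply (incr_inj (Nat.iter n f0)); [exact (G_strictly_incr _ GF)|].
    rewrite (Hcomm (Nat.iter n f0) g) by assumption.
    rewrite !(iter_contract_a f0 mu e0) by (auto; nra).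
    rewrite Hg by nra. ring. }
  assert (Hgb : forall y, b - e1 <= y <= b -> b - e1 <= g y <= b -> b - g y = m' * (b - y)).
  { intros y Hy Hgy. destruct Hm' as (eg & Heg & Hg').
    destruct (pow_small nu (eg / e1)) as [n Hn]; [exact Hnu|apply Rdiv_lt_0_compat; lra|].
    pose proof (iter_in_group G f1 n HG Gf1) as GF.
    assert (Hpos : 0 < nu ^ n) by (apply pow_lt; lra).
    assert (Hde : eg / e1 * e1 = eg) by (field; lra).
    assert (nu ^ n * (b - y) <= eg) by nra.
    pose proof (Hcomm (Nat.iter n f1) g y GF Gg) as E.
    rewrite !(iter_contract_b f1 nu e1) in E by (auto; nra).
    rewrite (Hg' (b - nu ^ n * (b - y))) in E by nra.
    apply Rmult_eq_reg_l with (nu ^ n); [nra|lra]. }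
  assert (key : forall x, x0 <= x <= x0 + d / 2 ->
    sl * ((m - 1) * (x - a)) = (1 - m') * (b - f x) /\ y0 < f x < b).
  { intros x Hx.
    assert (Hgx : g x = a + m * (x - a)) by (apply Hga; lra).
    assert (Hgx2 : x < g x <= x0 + d) by nra.
    assert (Hfx1 : y0 < f x).
    { apply Rlt_le_trans with (f x0); [exact Hfx|]. apply incr_le; [exact If|lra]. }
    assert (Hfx2 : f x < f (g x)) by (apply If; lra).
    assert (Hfx3 : f (g x) < b) by (apply G_range; [exact Gf|lra]).
    split; [|lra].
    assert (E : f (g x) = f x + sl * ((m - 1) * (x - a))).
    { rewrite (Hsl (g x)), (Hsl x) by lra. rewrite Hgx. ring. }
    rewrite (Hcomm f g) in * by assumption.
    assert (b - g (f x) = m' * (b - f x)) by (apply Hgb; lra). lra. }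
  destruct (key x0) as [K1 B1]; [lra|]. destruct (key (x0 + d / 2)) as [K2 B2]; [lra|].
  assert (f x0 < f (x0 + d / 2)) by (apply If; lra).
  assert (0 < sl * ((m - 1) * (x0 - a))) by (repeat apply Rmult_lt_0_compat; lra).
  assert (sl * ((m - 1) * (x0 - a)) < sl * ((m - 1) * (x0 + d / 2 - a))).
  { apply Rmult_lt_compat_l; [lra|]. apply Rmult_lt_compat_l; lra. }
  assert (0 < 1 - m') by nra. nra.
Qed.

Lemma contains_F_nondiscrete : nondiscrete_slopes -> contains_F G.
Proof.
  intros HN. apply NNPP. intros Hno. apply (nondiscrete_kernel_nontrivial HN).
  intros k Gk Hk x. apply NNPP. intros Hx. apply Hno.
  destruct (slope_b_ex k Gk) as [nu Hnu]. destruct (Req_dec nu 1) as [->|Hne].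
  - exact (contains_F_nondiscrete_kernel k x HN Gk Hk Hnu Hx).
  - exact (contains_F_one_sided k nu Gk Hk Hnu Hne).
Qed.

End SingleOrbital.

(** * Generating sets *)

Definition same_group (l l' : list (R -> R)) : Prop :=
  forall f, gen_list l f <-> gen_list l' f.

Lemma gen_list_ext l f f' : gen_list l f' -> (forall t, f t = f' t) -> gen_list l f.
Proof. intros H E. apply functional_extensionality in E. subst. exact H. Qed.

Lemma same_group_intro l l' : (forall f, In f l -> gen_list l' f) ->
  (forall f, In f l' -> gen_list l f) -> same_group l l'.
Proof. intros H H' f. split; apply gen_list_mono; assumption. Qed.

Lemma same_group_trans l l' l'' : same_group l l' -> same_group l' l'' -> same_group l l''.
Proof. intros H H' f. rewrite (H f). apply H'. Qed.

Lemma same_group_replace l1 f f' l2 :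
  gen_list (l1 ++ f :: l2) f' -> gen_list (l1 ++ f' :: l2) f ->
  same_group (l1 ++ f :: l2) (l1 ++ f' :: l2).
Proof.
  intros H H'. apply same_group_intro; intros g Hg;
    apply in_app_or in Hg as [Hg|[<-|Hg]]; auto;
    apply gen_in, in_or_app; simpl; auto.
Qed.

Lemma same_group_swap f g l : same_group (f :: g :: l) (g :: f :: l).
Proof. apply same_group_intro; intros h Hh; apply gen_in; simpl in *; tauto. Qed.

Lemma same_group_cons f l l' : same_group l l' -> same_group (f :: l) (f :: l').
Proof.
  intros H. apply same_group_intro; intros g [<-|Hg]; try (apply gen_in; left; reflexivity).
  - apply (gen_list_mono l'); [intros; apply gen_in; right; assumption|].
    apply H, gen_in, Hg.
  - apply (gen_list_mono l); [intros; apply gen_in; right; assumption|].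
    apply H, gen_in, Hg.
Qed.

Lemma same_group_mult f g gi l : (forall t, gi (g t) = t) -> (forall t, g (gi t) = t) ->
  same_group (f :: g :: l) ((fun t => g (f t)) :: g :: l).
Proof.
  intros E1 E2. apply (same_group_replace [] f (fun t => g (f t)) (g :: l)); simpl.
  - apply gen_mul; apply gen_in; simpl; auto.
  - apply (gen_list_ext _ _ (fun t => gi (g (f t)))); [|intros; symmetry; apply E1].
    apply (gen_mul _ (fun t => g (f t)) gi); [apply gen_in; simpl; auto|].
    apply (gen_inv _ g gi); [apply gen_in; simpl; auto|exact E1|exact E2].
Qed.

Lemma same_group_mult_inv f g gi l : (forall t, gi (g t) = t) -> (forall t, g (gi t) = t) ->
  same_group (f :: g :: l) ((fun t => gi (f t)) :: g :: l).
Proof.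
  intros E1 E2. apply (same_group_replace [] f (fun t => gi (f t)) (g :: l)); simpl.
  - apply gen_mul; [apply gen_in; simpl; auto|].
    apply (gen_inv _ g gi); [apply gen_in; simpl; auto|exact E1|exact E2].
  - apply (gen_list_ext _ _ (fun t => g (gi (f t)))); [|intros; symmetry; apply E2].
    apply (gen_mul _ (fun t => gi (f t)) g); apply gen_in; simpl; auto.
Qed.

(** * Euclidean reduction of a generating set *)

Section Euclid.

Variable G : (R -> R) -> Prop.
Hypothesis HG : incr_group G.
Variable lam : (R -> R) -> R.
Hypothesis lam_mul : forall f g, G f -> G g -> lam (fun t => g (f t)) = lam f + lam g.
Variable lam0 : R.
Hypothesis lam0_pos : 0 < lam0.
Hypothesis lam_discrete : forall f, G f -> lam f = 0 \/ lam0 <= Rabs (lam f).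

Lemma lam_inv f h : G f -> G h -> (forall t, h (f t) = t) -> lam h = - lam f.
Proof.
  intros Gf Gh E. pose proof HG as (Gid & _).
  pose proof (lam_mul f h Gf Gh) as H.
  pose proof (lam_mul (fun t => t) (fun t => t) Gid Gid) as H'. simpl in H'.
  replace (fun t => h (f t)) with (fun t : R => t) in H
    by (apply functional_extensionality; intros; symmetry; apply E).
  lra.
Qed.

(** The number [N] bounds the total size in units of [lam0]. Each step costs at least one unit,
    because a nonzero value of [lam] is at least [lam0] in absolute value. *)
Lemma euclid_pair N f g l : G f -> G g ->
  Rabs (lam f) + Rabs (lam g) <= INR N * lam0 ->
  exists f' g', G f' /\ G g' /\ same_group (f :: g :: l) (f' :: g' :: l) /\ lam g' = 0.
Proof.
  revert f g. induction N as [|N IH]; intros f g Gf Gg HN.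
  - exists f, g. repeat split; auto. simpl in HN.
    pose proof (Rabs_pos (lam f)). pose proof (Rabs_pos (lam g)).
    destruct (lam_discrete g Gg); lra.
  - pose proof HG as (_ & Gmul & Ginv & _). rewrite S_INR in HN.
    assert (Hred : forall f g, G f -> G g -> Rabs (lam g) <= Rabs (lam f) -> lam g <> 0 ->
      Rabs (lam f) + Rabs (lam g) <= (INR N + 1) * lam0 ->
      exists f' g', G f' /\ G g' /\ same_group (f :: g :: l) (f' :: g' :: l) /\ lam g' = 0).
    { clear f g Gf Gg HN. intros f g Gf Gg Hfg Hne HN.
      destruct (Ginv g Gg) as (gi & Ggi & E1 & E2).
      destruct (lam_discrete g Gg) as [H0|H0]; [contradiction|].
      (* Equal signs call for the difference, opposite signs for the sum. *)
      assert (Hcase : Rabs (lam f - lam g) <= Rabs (lam f) - lam0 \/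
                      Rabs (lam f + lam g) <= Rabs (lam f) - lam0).
      { revert Hfg H0. unfold Rabs.
        destruct (Rcase_abs (lam f)); destruct (Rcase_abs (lam g));
        destruct (Rcase_abs (lam f - lam g)); destruct (Rcase_abs (lam f + lam g));
        intros; lra. }
      destruct Hcase as [Hc|Hc].
      - destruct (IH (fun t => gi (f t)) g) as (f' & g' & Gf' & Gg' & Hs & Hz); auto.
        { rewrite lam_mul, (lam_inv g gi) by auto.
          replace (lam f + - lam g) with (lam f - lam g) by ring. lra. }
        exists f', g'. split; [exact Gf'|]. split; [exact Gg'|]. split; [|exact Hz].
        exact (same_group_trans _ _ _ (same_group_mult_inv f g gi l E1 E2) Hs).
      - destruct (IH (fun t => g (f t)) g) as (f' & g' & Gf' & Gg' & Hs & Hz); auto.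
        { rewrite lam_mul by auto. lra. }
        exists f', g'. split; [exact Gf'|]. split; [exact Gg'|]. split; [|exact Hz].
        exact (same_group_trans _ _ _ (same_group_mult f g gi l E1 E2) Hs). }
    destruct (Req_dec (lam g) 0) as [Hg0|Hg0].
    { exists f, g. split; [exact Gf|]. split; [exact Gg|].
      split; [intros h; reflexivity|exact Hg0]. }
    destruct (Req_dec (lam f) 0) as [Hf0|Hf0].
    { exists g, f. split; [exact Gg|]. split; [exact Gf|].
      split; [apply same_group_swap|exact Hf0]. }
    destruct (Rle_dec (Rabs (lam g)) (Rabs (lam f))) as [H|H]; [auto|].
    destruct (Hred g f) as (f' & g' & Gf' & Gg' & Hs & Hz); auto; try lra.
    exists f', g'. split; [exact Gf'|]. split; [exact Gg'|]. split; [|exact Hz].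
    exact (same_group_trans _ _ _ (same_group_swap f g l) Hs).
Qed.

Lemma euclid_list l : (forall f, In f l -> G f) -> l <> [] ->
  exists f l', S (length l') = length l /\ G f /\ (forall g, In g l' -> G g /\ lam g = 0) /\
    same_group l (f :: l').
Proof.
  induction l as [|f l IH]; intros Hl Hne; [congruence|].
  destruct l as [|g l].
  - exists f, []. split; [reflexivity|]. split; [apply Hl; left; reflexivity|].
    split; [intros g []|intros h; reflexivity].
  - destruct IH as (g1 & l1 & Hlen & Gg1 & Hl1 & Hs).
    { intros; apply Hl; right; assumption. }
    { congruence. }
    destruct (INR_unbounded ((Rabs (lam f) + Rabs (lam g1)) / lam0)) as [N HN].
    assert (Gf : G f) by (apply Hl; left; reflexivity).
    destruct (euclid_pair N f g1 l1) as (f' & g' & Gf' & Gg' & Hs' & Hz); auto.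
    { assert (E : (Rabs (lam f) + Rabs (lam g1)) / lam0 * lam0 = Rabs (lam f) + Rabs (lam g1))
        by (field; lra). nra. }
    exists f', (g' :: l1). split; [simpl in *; lia|]. split; [exact Gf'|]. split.
    + intros h [<-|Hh]; auto.
    + exact (same_group_trans _ _ _ (same_group_cons f _ _ Hs) Hs').
Qed.

End Euclid.

(** * Separating the boundaries of fixed sets *)

Definition boundary_disjoint (f g : R -> R) : Prop :=
  forall t, ~ (fix_boundary f t /\ fix_boundary g t).

Lemma boundary_disjoint_geom_proper l : ForallOrdPairs boundary_disjoint l -> geom_proper l.
Proof.
  intros H f g t Hf Hg Hne.
  assert (Hd : ~ (fix_boundary f t /\ fix_boundary g t)).
  { destruct (ForallOrdPairs_In H f g Hf Hg) as [E|[E|E]]; [contradiction|apply E|].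
    intros [H1 H2]. apply (E t). auto. }
  split; intros [H1 H2]; apply Hd; split;
    auto using left_transition_boundary, right_transition_boundary.
Qed.

(** The conjugator comes from the other generators, so it is still available after [g] has been
    replaced and the conjugation can be undone. *)
Lemma same_group_conj g w wi l1 l2 : (forall t, wi (w t) = t) -> (forall t, w (wi t) = t) ->
  gen_list (l1 ++ l2) w -> same_group (l1 ++ g :: l2) (l1 ++ (fun t => w (g (wi t))) :: l2).
Proof.
  intros E1 E2 Hw.
  assert (Hw' : forall g', gen_list (l1 ++ g' :: l2) w).
  { intros g'. eapply gen_list_mono; [|exact Hw]. intros f Hf. apply gen_in.
    apply in_app_or in Hf as [Hf|Hf]; apply in_or_app; simpl; auto. }
  assert (Hwi : forall g', gen_list (l1 ++ g' :: l2) wi).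
  { intros g'. apply (gen_inv _ w wi); auto. apply Hw'. }
  apply same_group_replace.
  - apply (gen_mul _ (fun t => g (wi t)) w); [|apply Hw'].
    apply (gen_mul _ wi g); [apply Hwi|apply gen_in, in_or_app; simpl; auto].
  - set (g' := fun t => w (g (wi t))).
    apply (gen_list_ext _ _ (fun t => wi (g' (w t))));
      [|intros; unfold g'; rewrite !E1; reflexivity].
    apply (gen_mul _ (fun t => g' (w t)) wi); [|apply Hwi].
    apply (gen_mul _ w g'); [apply Hw'|apply gen_in, in_or_app; simpl; auto].
Qed.

Lemma gen_list_fixes l t : (forall f, In f l -> f t = t) -> forall f, gen_list l f -> f t = t.
Proof.
  intros H f Hf. induction Hf; auto.
  - congruence.
  - rewrite <- IHHf at 1. auto.
Qed.

(* A boundary point of Fix(g) inside the support of the group is fixed by g, hence is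
   moved by the group generated by the remaining elements; conjugating g by an element
   of that group therefore separates its boundary points from all others. *)
Lemma separate_boundaries a b todo done :
  (forall f, In f (todo ++ done) -> PL_homeo f) ->
  (forall t, a < t < b -> exists f, gen_list (todo ++ done) f /\ f t <> t) ->
  (forall g, In g todo -> forall t, fix_boundary g t -> a < t < b) ->
  ForallOrdPairs boundary_disjoint done ->
  exists hs, length hs = length (todo ++ done) /\ same_group hs (todo ++ done) /\
    ForallOrdPairs boundary_disjoint hs.
Proof.
  revert done. induction todo as [|g todo IH]; intros done HPL Hmove Hin Hd.
  - exists done. split; [reflexivity|]. split; [intros f; reflexivity|exact Hd].
  - simpl in *.
    assert (HPLg : PL_homeo g) by auto.
    assert (HPL' : forall f, In f (todo ++ done) -> PL_homeo f) by auto.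
    pose proof (gen_list_incr_group _ HPL') as HG'.
    destruct (fix_boundary_list g HPLg) as [L HL].
    assert (HLd : exists L', forall f t, In f done -> fix_boundary f t -> In t L').
    { assert (Hdone : forall f, In f done -> PL_homeo f)
        by (intros; apply HPL'; auto using in_or_app).
      clear -Hdone. induction done as [|f done IH].
      - exists []. intros f t [].
      - destruct IH as [L' HL']; [intros; apply Hdone; right; assumption|].
        destruct (fix_boundary_finite f) as [L2 HL2]; [apply Hdone; left; reflexivity|].
        exists (L2 ++ L'). intros f' t [<-|Hf'] Ht; apply in_or_app; eauto. }
    destruct HLd as [L' HL'].
    destruct (move_off (gen_list (todo ++ done)) L L' HG') as (w & Gw & Hw).
    { intros t Ht. apply HL in Ht. apply NNPP. intros Hno.
      destruct (Hmove t) as (f & Gf & Hf); [eapply Hin; eauto|].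
      apply Hf. apply (gen_list_fixes (g :: todo ++ done)); [|exact Gf].
      intros h [<-|Hh]; [apply Ht|]. apply NNPP. intros Hne. apply Hno.
      exists h. split; [apply gen_in, Hh|exact Hne]. }
    pose proof HG' as (_ & _ & Ginv & Ginc).
    destruct (Ginv w Gw) as (wi & Gwi & E1 & E2).
    set (g' := fun t => w (g (wi t))).
    assert (Hbd : forall t, fix_boundary g' t -> fix_boundary g (wi t)).
    { intros t Ht. apply (fix_boundary_conj g w wi t); auto;
        [exact (Ginc w Gw)|exact (Ginc wi Gwi)]. }
    assert (Hsame : same_group (g :: todo ++ done) (todo ++ g' :: done)).
    { apply same_group_trans with (todo ++ g :: done).
      - apply same_group_intro; intros f Hf; apply gen_in;
          [destruct Hf as [<-|Hf]; [|apply in_app_or in Hf as [Hf|Hf]];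
             apply in_or_app; simpl; auto|].
        simpl. apply in_app_or in Hf as [Hf|[<-|Hf]]; auto using in_or_app.
      - apply same_group_conj; auto. }
    assert (HPLw : PL_homeo w) by (apply (gen_list_PL_homeo (todo ++ done)); auto).
    assert (HPLwi : PL_homeo wi) by (apply (gen_list_PL_homeo (todo ++ done)); auto).
    destruct (IH (g' :: done)) as (hs & Hlen & Hs & Hp).
    + intros f Hf. apply in_app_or in Hf as [Hf|[<-|Hf]]; auto using in_or_app.
      apply (PL_homeo_comp (fun t => g (wi t)) w); [|exact HPLw].
      apply (PL_homeo_comp wi g); assumption.
    + intros t Ht. destruct (Hmove t Ht) as (f & Gf & Hf). exists f. split; [|exact Hf].
      apply Hsame, Gf.
    + intros h Hh t Ht. apply (Hin h); auto.
    + constructor; [|exact Hd]. apply Forall_forall. intros f Hf t [H1 H2].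
      apply (Hw (wi t)); [apply HL, Hbd, H1|]. rewrite E2. apply (HL' f); assumption.
    + exists hs. split; [|split; [|exact Hp]].
      * rewrite Hlen, !length_app. simpl. lia.
      * intros f. rewrite (Hs f). symmetry. apply Hsame.
Qed.

Lemma fix_boundary_between f l r t :
  (forall x, x <= l -> f x = x) -> (forall x, r <= x -> f x = x) ->
  fix_boundary f t -> l <= t <= r.
Proof.
  intros Hl Hr [_ H]. split; apply Rnot_lt_le; intros Hlt.
  - destruct (H (l - t)) as (s & Hs & Hm); [lra|]. apply Hm, Hl. lra.
  - destruct (H (t - r)) as (s & Hs & Hm); [lra|]. apply Hm, Hr. lra.
Qed.

Lemma geom_proper_trivial l : (forall f t, In f l -> f t = t) -> geom_proper l.
Proof.
  intros H f g t Hf Hg Hne. exfalso. apply Hne.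
  apply functional_extensionality. intros x. rewrite !H; auto.
Qed.

(** If [f] moves [x], then [f x] and the preimage of [x] are moved too and lie on opposite sides of
    [x]. Hence the support attains neither its infimum nor its supremum, and connectedness fills in
    everything between them. *)
Lemma support_interval l : (forall f, In f l -> PL_homeo f) ->
  connected_set (group_supp (gen_list l)) -> (exists f t, In f l /\ f t <> t) ->
  exists a b, a < b /\
    (forall f, gen_list l f -> forall x, x <= a \/ b <= x -> f x = x) /\
    (forall x, a < x < b -> exists f, gen_list l f /\ f x <> x).
Proof.
  intros HPL Hconn (f0 & t0 & Hf0 & Ht0).
  set (G := gen_list l). set (A := group_supp G).
  pose proof (gen_list_incr_group l HPL) as (_ & Gmul & Ginv & Ginc).
  assert (HGA : forall f x, G f -> f x <> x -> A x).
  { intros f x Gf Hx. exists f. split; [exact Gf|]. split; [|exact Hx].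
    destruct (gen_list_PL_homeo l HPL f Gf) as (_ & _ & _ & Hout).
    apply NNPP. intros H. apply Hx, Hout. lra. }
  assert (HAopen : forall x, A x -> exists y z, A y /\ A z /\ y < x < z).
  { intros x (f & Gf & _ & Hx). destruct (Ginv f Gf) as (h & Gh & E1 & E2).
    assert (Ah : A (h x)).
    { apply (HGA f); [exact Gf|]. intros E. apply Hx.
      rewrite E2 in E. rewrite E at 1. apply E2. }
    assert (Af : A (f x)).
    { apply (HGA f); [exact Gf|]. intros E. apply Hx.
      apply (incr_inj f); [exact (Ginc f Gf)|exact E]. }
    destruct (Rdichotomy _ _ Hx) as [H|H].
    - exists (f x), (h x). repeat split; auto.
      rewrite <- (E1 x) at 1. apply (Ginc h Gh), H.
    - exists (h x), (f x). repeat split; auto.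
      rewrite <- (E1 x) at 2. apply (Ginc h Gh), H. }
  assert (A0 : A t0) by (apply (HGA f0); [apply gen_in, Hf0|exact Ht0]).
  destruct (completeness A) as [b [Hub Hlub]].
  { exists 1. intros x (f & _ & Hx & _). lra. }
  { exists t0. exact A0. }
  destruct (completeness (fun x => A (- x))) as [a' [Hub' Hlub']].
  { exists 0. intros x (f & _ & Hx & _). lra. }
  { exists (- t0). rewrite Ropp_involutive. exact A0. }
  assert (Hlow : forall x, A x -> - a' <= x).
  { intros x Hx. assert (- x <= a'); [|lra]. apply Hub'. rewrite Ropp_involutive. exact Hx. }
  assert (Hstrict : forall x, A x -> - a' < x < b).
  { intros x Hx. destruct (HAopen x Hx) as (y & z & Hy & Hz & Hyz).
    apply Hlow in Hy. apply Hub in Hz. lra. }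
  exists (- a'), b. split; [pose proof (Hstrict t0 A0); lra|]. split.
  - intros f Gf x Hx. apply NNPP. intros Hne.
    pose proof (Hstrict x (HGA f x Gf Hne)). lra.
  - intros x Hx.
    assert (Hy : exists y, A y /\ y <= x).
    { apply NNPP. intros Hno. assert (a' <= - x); [|lra]. apply Hlub'. intros y Hy.
      apply Rnot_lt_le. intros Hlt. apply Hno. exists (- y). split; [exact Hy|lra]. }
    assert (Hz : exists z, A z /\ x <= z).
    { apply NNPP. intros Hno. assert (b <= x); [|lra]. apply Hlub. intros y Hy'.
      apply Rnot_lt_le. intros Hlt. apply Hno. exists y. split; [exact Hy'|lra]. }
    destruct Hy as (y & Ay & Hy). destruct Hz as (z & Az & Hz).
    destruct (Hconn y z x Ay Az) as (f & Gf & _ & Hfx); [lra|]. eauto.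
Qed.

Theorem theorem1p5 (n : nat) (gens : list (R -> R)) :
  length gens = n ->
  (forall f, In f gens -> PL_plus f) ->
  connected_set (group_supp (gen_list gens)) ->
  contains_F (gen_list gens) \/
  exists hs : list (R -> R),
    length hs = n /\
    (forall f, gen_list hs f <-> gen_list gens f) /\
    geom_proper hs.
Proof.
  intros Hn Hplus Hconn.
  assert (HPL : forall f, In f gens -> PL_homeo f) by (intros; apply PL_plus_homeo; auto).
  destruct (classic (exists f t, In f gens /\ f t <> t)) as [Hex|Hno].
  2:{ right. exists gens. split; [exact Hn|]. split; [reflexivity|].
      apply geom_proper_trivial. intros f t Hf. apply NNPP. intros Hne. apply Hno. eauto. }
  destruct (support_interval gens HPL Hconn Hex) as (a & b & Hab & Hfix & Hmove).
  set (G := gen_list gens) in *.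
  pose proof (gen_list_incr_group gens HPL : incr_group G) as HG.
  assert (GPL : forall f, G f -> PL_homeo f) by (apply gen_list_PL_homeo; exact HPL).
  assert (GLPL : forall f, G f -> locally_PL f) by (intros f Gf; apply GPL, Gf).
  destruct (classic (nondiscrete_slopes G a)) as [Hnd|Hdisc].
  { left. exact (contains_F_nondiscrete G HG GLPL a b Hab Hfix Hmove Hnd). }
  destruct (classic (contains_F G)) as [HF|HnF]; [left; exact HF|right].
  assert (Hgap : exists eps, 0 < eps /\
    forall g m, G g -> slope_a a g m -> 1 < m -> 1 + eps <= m).
  { apply NNPP. intros H. apply Hdisc. intros eps He. apply NNPP. intros H'.
    apply H. exists eps. split; [exact He|]. intros g m Gg Hg Hm.
    apply Rnot_lt_le. intros Hlt. apply H'. exists g, m. auto. }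
  destruct Hgap as (eps & Heps & Hgap).
  pose (sl := fun f => epsilon (inhabits 0) (slope_a a f)).
  assert (Hsl : forall f, G f -> slope_a a f (sl f)).
  { intros f Gf. apply epsilon_spec. apply (slope_a_ex G GLPL a b Hfix f Gf). }
  assert (Hslp : forall f, G f -> 0 < sl f).
  { intros f Gf. apply (slope_a_pos G HG a b Hfix f); auto. }
  (* The logarithm makes the slope additive. The gap concerns slopes above 1; those below 1 inherit
     it through inverses. *)
  destruct (euclid_list G HG (fun f => ln (sl f))) with (lam0 := ln (1 + eps)) (l := gens)
    as (f1 & l1 & Hlen & Gf1 & Hl1 & Hs1).
  { intros f g Gf Gg. rewrite <- ln_mult by auto. f_equal.
    apply (slope_a_unique a (fun t => g (f t))).
    - apply Hsl. apply gen_mul; assumption.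
    - rewrite Rmult_comm. apply (slope_a_comp G HG a b Hfix); auto. }
  { rewrite <- ln_1. apply ln_increasing; lra. }
  { intros f Gf. destruct (Rtotal_order (sl f) 1) as [Hlt|[Heq|Hgt]].
    - right. pose proof HG as (_ & _ & Ginv & _).
      destruct (Ginv f Gf) as (h & Gh & E1 & E2).
      pose proof (slope_a_inv G HG a b Hfix f h (sl f) Gf Gh E1 (Hsl f Gf)) as Hh.
      pose proof (Hslp f Gf).
      assert (Hle : 1 + eps <= / sl f).
      { apply (Hgap h); auto. rewrite <- Rinv_1. apply Rinv_lt_contravar; lra. }
      assert (Hln : ln (1 + eps) <= ln (/ sl f)).
      { destruct Hle as [Hle| ->]; [left; apply ln_increasing; lra|lra]. }
      rewrite ln_Rinv in Hln by assumption.
      pose proof (Rle_abs (- ln (sl f))). rewrite Rabs_Ropp in *. lra.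
    - left. rewrite Heq. apply ln_1.
    - right. assert (Hle : 1 + eps <= sl f) by (apply (Hgap f); auto).
      assert (Hln : ln (1 + eps) <= ln (sl f)).
      { destruct Hle as [Hle| ->]; [left; apply ln_increasing; lra|lra]. }
      pose proof (Rle_abs (ln (sl f))). lra. }
  { intros f Hf. apply gen_in, Hf. }
  { intros ->. destruct Hex as (f & t & [] & _). }
  assert (Hs : same_group (l1 ++ [f1]) gens).
  { intros f. rewrite (Hs1 f).
    apply same_group_intro; intros h Hh; apply gen_in.
    - apply in_app_or in Hh as [Hh|[<-|[]]]; simpl; auto.
    - apply in_or_app. destruct Hh as [<-|Hh]; simpl; auto. }
  (* The boundary of the fixed set of [f1] may contain a or b, which no element moves; so [f1]
     starts among the finished elements and is never conjugated. *)
  destruct (separate_boundaries a b l1 [f1]) as (hs & Hlh & Hsh & Hdh).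
  - intros f Hf. apply GPL, Hs, gen_in, Hf.
  - intros t Ht. destruct (Hmove t Ht) as (f & Gf & Hf). exists f. split; [apply Hs, Gf|exact Hf].
  - intros g Hg t Ht. destruct (Hl1 g Hg) as [Gg Hlam].
    assert (Ha : slope_a a g 1).
    { replace 1 with (sl g); [apply Hsl, Gg|].
      apply ln_inv; [auto|lra|]. rewrite ln_1. exact Hlam. }
    assert (Hb : slope_b b g 1).
    (* Slope 1 at a together with another slope at b would produce F, which [HnF] excludes. *)
    { destruct (slope_b_ex G GLPL a b Hfix g Gg) as [nu Hnu].
      destruct (Req_dec nu 1) as [->|Hne]; [exact Hnu|]. exfalso. apply HnF.
      exact (contains_F_one_sided G HG GLPL a b Hab Hfix Hmove g nu Gg Ha Hnu Hne). }
    destruct (slope_a_one_trivial G a b Hab Hfix g Gg Ha) as (l & Hl & Hidl).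
    destruct (slope_b_one_trivial G a b Hab Hfix g Gg Hb) as (r & Hr & Hidr).
    pose proof (fix_boundary_between g l r t Hidl Hidr Ht).
    lra.
  - repeat constructor.
  - exists hs. split; [|split].
    + rewrite Hlh, length_app. simpl. lia.
    + intros f. rewrite (Hsh f). apply Hs.
    + apply boundary_disjoint_geom_proper, Hdh.
Qed.
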